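(* Let $P$ be a point process on $X$ whose Campbell measure admits a Papangelou density $c(x;\omega)$ with respect to $\lambda\otimes P$. Let $n,r\ge 1$ and let $u : X^r \times \Omega^X \to \mathbb{R}$ be a measurable $r$-process such that both sides of the identity below make sense (i.e. either $u\ge 0$, or the right-hand side with $u$ replaced by $|u|$ is finite). Then $$ \mathbb{E}\left[\left(\int_{X^r} u(z_1,\ldots,z_r;\omega)\,\omega(dz_1)\cdots\omega(dz_r)\right)^n\right] =\sum_{\rho\in\Pi[n\times r]}\mathbb{E}\left[\int_{X^{|\rho|}}\epsilon^+_{\mathfrak{z}_{|\rho|}}\prod_{k=1}^n u\big(z^\rho_{\pi_k}\big)\,\hat\lambda^{|\rho|}(d\mathfrak{z}_{|\rho|})\right], $$ where $z^\rho_{\pi_k}:=(z_{\zeta^\rho(k,1)},\ldots,z_{\zeta^\rho(k,r)})$, $k=1,\ldots,n$.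
   Context: $X$ is a Polish space with Borel $\sigma$-algebra $\mathcal{B}(X)$ and a $\sigma$-finite non-atomic measure $\lambda$. $\Omega^X$ is the space of locally finite configurations $\omega\subset X$ (i.e. $\#(A\cap\omega)<\infty$ for all compact $A$), with $\omega$ identified with the Radon measure $\sum_{x\in\omega}\epsilon_x$ ($\epsilon_x$ = Dirac measure at $x$). A point process is a probability measure $P$ on $\Omega^X$ with the $\sigma$-algebra $\mathcal{F}$ generated by the vague topology; $\mathbb{E}$ is expectation under $P$. The Campbell measure is $C(A\times B)=\mathbb{E}[\int_A \mathbf{1}_B(\omega\setminus\{x\})\,\omega(dx)]$, $A\in\mathcal{B}(X)$, $B\in\mathcal{F}$. The Papangelou density $c$ is defined by $C(dx,d\omega)=c(x;\omega)\,\lambda(dx)\,P(d\omega)$ (absolute continuity is assumed). The compound Campbell density $\hat c$ is defined inductively by $\hat c(\emptyset;\omega)=1$ and $\hat c(\{x_1,\ldots,x_n,y\};\omega)=c(y;\omega)\,\hat c(\{x_1,\ldots,x_n\};\omega\cup\{y\})$, $n\ge0$. For $\mathfrak{x}_n=(x_1,\ldots,x_n)$, $\hat\lambda^n(d\mathfrak{x}_n)=\hat c(\{x_1,\ldots,x_n\};\omega)\,\lambda(dx_1)\cdots\lambda(dx_n)$ is a random measure on $X^n$. For $\mathfrak{z}_m=(z_1,\ldots,z_m)\in X^m$, $\epsilon^+_{\mathfrak{z}_m}$ is the operator that replaces $\omega$ by $\omega\cup\{z_1,\ldots,z_m\}$ in everything it acts on: $(\epsilon^+_{\mathfrak{z}_m}F)(\omega)=F(\omega\cup\{z_1,\ldots,z_m\})$;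 thus $\epsilon^+_{\mathfrak{z}_m}\prod_k u(\cdot)=\prod_k u(\,\cdot\,;\omega\cup\{z_1,\ldots,z_m\})$. The variable $\omega$ in $u$ is omitted. $\Pi[n\times r]$ is the set of all partitions of $\Delta_{n\times r}=\{1,\ldots,n\}\times\{1,\ldots,r\}$, and $\pi_k=\{(k,1),\ldots,(k,r)\}$. For $\rho=\{\rho_1,\ldots,\rho_m\}\in\Pi[n\times r]$, $|\rho|=m$ is the number of blocks, and $\zeta^\rho(k,l)=p$ if and only if $(k,l)\in\rho_p$.
   Formalization: The random variable in the definition of the Campbell measure is required to be measurable for the vague sigma-algebra; this is automatic for locally compact X and fails at any point without a compact neighbourhood, where the Campbell measure is undefined. X is taken nonempty. *)

(* Defs.v *)
From HB Require Import structures.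
From mathcomp Require Import all_boot all_order all_algebra.
From mathcomp Require Import all_classical all_reals all_analysis measurable_realfun.
Import Order.TTheory GRing.Theory Num.Theory.
Import numFieldNormedType.Exports.

Set Implicit Arguments.
Unset Strict Implicit.
Unset Printing Implicit Defensive.

Local Open Scope classical_set_scope.
Local Open Scope ring_scope.

(* A complete pseudometric space in which distinct points are separated is a
   complete metric space. *)
Definition polish (R : realType) (X : completePseudoMetricType R) : Prop :=
  hausdorff_space X /\ exists2 D : set X, countable D & dense D.

Notation borel X := (g_sigma_algebraType (@open X)).

Definition atom d (T : measurableType d) (R : realType) (mu : set T -> \bar R)
    (A : set T) : Prop :=
  [/\ measurable A, (0 < mu A)%E &
    forall B, measurable B -> B `<=` A -> (mu B < mu A)%E -> mu B = 0%E].

Definition non_atomic d (T : measurableType d) (R : realType)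
    (mu : set T -> \bar R) : Prop :=
  forall A, ~ atom mu A.

Fixpoint power_measure d (T : measurableType d) (R : realType)
    (mu : set T -> \bar R) (n : nat) : set (n.-tuple T) -> \bar R :=
  match n with
  | 0 => \d_([tuple] : 0.-tuple T)
  | m.+1 => pushforward (mu \x @power_measure _ _ _ mu m)%E
              (fun p : T * m.-tuple T => [tuple of p.1 :: p.2])
  end.
Arguments power_measure {d T R} mu n.

Record config (X : ptopologicalType) := Config {
  points :> set X ;
  locally_finite : forall K : set X, compact K -> finite_set (K `&` points) }.

HB.instance Definition _ (X : ptopologicalType) := gen_eqMixin (config X).
HB.instance Definition _ (X : ptopologicalType) := gen_choiceMixin (config X).

Section config_operations.
Variable X : ptopologicalType.

Let locally_finite0 (K : set X) : compact K -> finite_set (K `&` set0).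
Proof. by rewrite setI0. Qed.

Definition config0 : config X := Config locally_finite0.

HB.instance Definition _ := isPointed.Build (config X) config0.

Let locally_finite_add (w : config X) (s : seq X) (K : set X) :
  compact K -> finite_set (K `&` (w `|` [set` s])).
Proof.
move=> cK; rewrite setIUr finite_setU; split; first exact: locally_finite.
exact: finite_setIr (finite_seq s).
Qed.

Definition config_add (w : config X) (s : seq X) : config X :=
  Config (@locally_finite_add w s).

Let locally_finite_del (w : config X) (x : X) (K : set X) :
  compact K -> finite_set (K `&` (w `\ x)).
Proof.
move=> cK; apply: sub_finite_set (locally_finite w cK).
by apply: setIS => y [].
Qed.

Definition config_del (w : config X) (x : X) : config X :=
  Config (@locally_finite_del w x).

End config_operations.

Section config_measure.
Variables (R : realType) (X : ptopologicalType) (w : config X).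
Local Open Scope ereal_scope.

Definition config_measure (A : set (borel X)) : \bar R :=
  \esum_(x in (w : set X)) \d_(x : borel X) A.

Let config_measure0 : config_measure set0 = 0.
Proof. by apply: esum1 => x _; rewrite dirac0. Qed.

Let config_measure_ge0 A : 0 <= config_measure A.
Proof. exact: esum_ge0. Qed.

Let config_measure_sigma_additive : semi_sigma_additive config_measure.
Proof.
move=> F mF tF mUF.
have -> : config_measure (\bigcup_n F n) = \sum_(n <oo) config_measure (F n).
  rewrite nneseries_esumT// /config_measure.
  transitivity (\esum_(x in (w : set X)) \esum_(n in [set: nat])
                  (\d_(x : borel X) (F n) : \bar R)).
    apply: eq_esum => x _; rewrite -nneseries_esumT//.
    exact/esym/cvg_lim/measure_semi_sigma_additive.
  rewrite !esum_esum//=.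
  rewrite (reindex_esum ([set: nat] `*` w) _ (fun p => (p.2, p.1)))//.
  split=> [[n x] [_ ?]//|[n x] [m y] _ _ /= [-> ->]//|[x n] [? _]].
  by exists (n, x).
by apply: is_cvg_nneseries => n _ _; exact: config_measure_ge0.
Qed.

HB.instance Definition _ := isMeasure.Build _ _ _ config_measure
  config_measure0 config_measure_ge0 config_measure_sigma_additive.

End config_measure.
Arguments config_measure R {X} w.

Section vague_topology.
Variables (R : realType) (X : completePseudoMetricType R).

Definition test_function : Type :=
  {f : X -> R | continuous f /\ compact (closure [set x | f x != 0])}.

HB.instance Definition _ := gen_eqMixin test_function.
HB.instance Definition _ := gen_choiceMixin test_function.

Definition vague_eval (w : config X) : {ptws test_function -> R} :=
  fun f => \int[config_measure R w]_x sval f x.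

(* The coarsest topology for which every w |-> vague_eval w f is continuous. *)
Definition vague : Type := initial_topology vague_eval.

HB.instance Definition _ := PointedTopological.on vague.

End vague_topology.

Notation Omega X := (g_sigma_algebraType (@open (vague X))).

Section point_process.
Variables (R : realType) (X : completePseudoMetricType R).
Local Open Scope ereal_scope.

Section campbell.
Variable P : probability (Omega X) R.

Definition campbell_integrand (A : set (borel X)) (B : set (Omega X))
    (w : Omega X) : \bar R :=
  \int[config_measure R w]_(x in A) (\1_B (config_del w x : Omega X))%:E.

Definition campbell (A : set (borel X)) (B : set (Omega X)) : \bar R :=
  \int[P]_w campbell_integrand A B w.

(* Library integrals are total, so the measurability needed for the Campbell
   measure to make sense has to be required.  It holds whenever X is Polish
   and locally compact; otherwise compactly supported functions do not see every point of X
   and not even w |-> #(A `&` w) need be measurable for the vague topology. *)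
Definition campbell_well_defined : Prop :=
  forall A B, measurable A -> measurable B ->
    measurable_fun [set: Omega X] (campbell_integrand A B).

Definition papangelou_density
    (lambda : {sigma_finite_measure set (borel X) -> \bar R})
    (c : borel X * Omega X -> \bar R) : Prop :=
  [/\ measurable_fun setT c, (forall p, 0 <= c p) &
    forall A B, measurable A -> measurable B ->
      campbell A B = \int[lambda \x P]_(p in A `*` B) c p].

End campbell.

(* The points are listed with the one that is removed first at the head.
   Without further assumptions on c different orderings of the same points may
   give different values, hence a function of sequences. *)
Fixpoint compound_campbell (c : borel X * Omega X -> \bar R) (s : seq X)
    (w : Omega X) : \bar R :=
  match s with
  | [::] => 1
  | y :: s' => c (y, w) * compound_campbell c s' (config_add w [:: y])
  end.

End point_process.

Definition partitions (n r : nat) : finType :=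
  {rho : {set {set 'I_n * 'I_r}} | finset.partition rho [set: 'I_n * 'I_r]%SET}.

Section partition_index.
Variables (n r : nat) (rho : partitions n r).

Lemma pblock_in_partition (a : 'I_n * 'I_r) : finset.pblock (val rho) a \in val rho.
Proof.
by apply: finset.pblock_mem; rewrite (finset.cover_partition (valP rho)) finset.in_setT.
Qed.

(* The blocks of rho are numbered rho_p = enum_val p. *)
Definition zeta (a : 'I_n * 'I_r) : 'I_#|val rho| :=
  enum_rank_in (pblock_in_partition a) (finset.pblock (val rho) a).

Lemma zetaP (a : 'I_n * 'I_r) (p : 'I_#|val rho|) :
  zeta a = p <-> a \in enum_val p.
Proof.
have trho := finset.partition_trivIset (valP rho).
split=> [<-|ap]; rewrite /zeta.
  rewrite enum_rankK_in ?pblock_in_partition// finset.mem_pblock.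
  by rewrite (finset.cover_partition (valP rho)) finset.in_setT.
apply: enum_val_inj; rewrite enum_rankK_in ?pblock_in_partition//.
exact: finset.def_pblock (enum_valP p) ap.
Qed.

Definition select (T : Type) (z : #|val rho|.-tuple T) (k : 'I_n) : r.-tuple T :=
  [tuple tnth z (zeta (k, l)) | l < r].

End partition_index.

Section partition_sum.
Variables (R : realType) (X : completePseudoMetricType R).
Variables (P : probability (Omega X) R) (n r : nat).
Local Open Scope ereal_scope.

Definition partition_sum
    (lambda : {sigma_finite_measure set (borel X) -> \bar R})
    (c : borel X * Omega X -> \bar R)
    (u : r.-tuple (borel X) * Omega X -> R) : \bar R :=
  \sum_(rho : partitions n r)
    \int[P]_w \int[power_measure lambda #|val rho|]_z
      ((\prod_(k < n) u (select z k, config_add w z : Omega X))%:E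
       * compound_campbell c z w).

End partition_sum.

(* Main.v *)
Require Import Defs.
From HB Require Import structures.
From mathcomp Require Import all_boot all_order all_algebra.
From mathcomp Require Import all_classical all_reals all_analysis measurable_realfun.
Import Order.TTheory GRing.Theory Num.Theory.
Import numFieldNormedType.Exports.

Set Implicit Arguments.
Unset Strict Implicit.
Unset Printing Implicit Defensive.

Local Open Scope classical_set_scope.
Local Open Scope ring_scope.
Local Open Scope ereal_scope.

(** For [u >= 0] and a fixed configuration [w], both sides come from one finite
    or infinite sum.  The inner integral is the sum of [u (z, w)] over the
    [r]-tuples [z] of points of [w], so its [n]-th power is a sum over families
    of points indexed by the [n * r] cells [(k, l)].  Grouping these families by
    the partition [rho] of the cells along which they coincide leaves, for each
    [rho], the sum of [\prod_k u (select z k, w)] over the tuples [z] of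
    [#|rho|] distinct points of [w] ([esum_partitions], [prod_config_integral]).

    The expectation of such a sum is computed by removing the points one at a
    time.  For one point this is the Georgii-Nguyen-Zessin formula
      E \sum_(x in w) h (x, w \ x) = E \int h (x, w) c (x, w) lambda(dx),
    the integrated form of the definition of the Papangelou density
    ([georgii_nguyen_zessin]); induction produces the compound density and the
    configuration enlarged by [z] ([iterated_gnz]).

    The definition of the density only speaks of measurable rectangles, and
    neither the Campbell measure nor the density is assumed to be sigma-finite.
    The rectangles [U * {w | w does not meet U}], for [U] in a countable base,
    have Campbell measure at most 1; as a configuration is closed and discrete
    they cover all pairs [(x, w)] with [x] outside [w].  The remaining pairs are
    null on both sides, by construction for the Campbell measure and because
    [lambda] has no atoms for the density.

    Measurability is reduced to compositions by enumerating the points of a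
    configuration measurably ([measurable_enumeration_exists]): whether the [n]-th
    set of a countable base isolates a point of [w] is decided by the counts of
    [w] on finitely many open sets.  Adding or removing a point is measurable
    because it translates the vague coordinates of [w] by an amount continuous
    in the point ([measurable_vague_translate]).

    A signed [u] is split into its positive and negative parts: the identity for
    products of [n] different nonnegative integrands is applied to each of the
    [2 ^ n] choices of parts, and all the terms are finite ([moment_signed]). *)

(** * Configurations as closed discrete sets *)

Definition base_seq (X : topologicalType) (U : nat -> set X) : Prop :=
  (forall n, open (U n)) /\
  forall x (A : set X), nbhs x A -> exists2 n, U n x & U n `<=` A.

(** The points of a countable dense set are told apart by an injection [e] to
    [nat]; the union defining [V] thus has at most one member, which avoids
    enumerating a set that could be finite. *)
Lemma polish_base_seq (R : realType) (X : completePseudoMetricType R) :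
  polish X -> exists U : nat -> set X, base_seq U.
Proof.
move=> [_ [D /countable_injP[e einj] dD]].
pose V (q : nat * nat) : set X :=
  \bigcup_(d in [set d | D d /\ e d = q.1]) (ball d (q.2.+1%:R^-1))°.
exists (fun n => if unpickle n is Some q then V q else set0); split.
  move=> n; case: unpickle => [q|]; last exact: open0.
  by apply: bigcup_open => d _; exact: open_interior.
move=> x A /nbhs_ballP[r /= r0 rA].
have [k kr] : exists k : nat, (k.+1%:R^-1 < r / 2)%R.
  have [//|k] := @ltr_add_invr R 0%R (r / 2) _; first by rewrite divr_gt0.
  by rewrite add0r => kr; exists k.
pose t : R := (k.+1%:R^-1 / 2)%R.
have t0 : (0 < t)%R by rewrite divr_gt0.
have tk : (t <= k.+1%:R^-1)%R by rewrite ler_pdivrMr// ler_peMr// ler1n.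
have [d [/interior_subset xd Dd]] : (ball x t)° `&` D !=set0.
  apply: dD; last exact: open_interior.
  by exists x; apply: nbhs_singleton; apply: nbhs_interior; exact: nbhsx_ballx.
exists (pickle (e d, k)); rewrite pickleK.
  exists d => //=; apply/nbhs_ballP; exists t => //= y xy.
  rewrite (splitr k.+1%:R^-1); apply: (@ball_triangle _ _ x) => //.
  exact: ball_sym.
move=> y [d' [Dd' /einj edd']] /interior_subset /= dy.
have {edd'}dd' : d' = d by apply: edd'; exact/mem_set.
rewrite dd' in dy; apply: rA; rewrite (splitr r).
apply: (@ball_triangle _ _ d).
  by apply: le_ball xd; rewrite (le_trans tk)// ltW.
by apply: le_ball dy; exact: ltW.
Qed.

(** A filter on the sequence and its limit that does not cluster at [x] lives on
    finitely many terms. *)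
Lemma compact_cvg_seq (X : topologicalType) (y : nat -> X) (x : X) :
  y @ \oo --> x -> compact (x |` range y).
Proof.
move=> yx F PF FK; case: (pselect (cluster F x)) => [Fx|/existsNP[A]].
  by exists x; split => //; left.
move=> /existsNP[B /not_implyP[FA /not_implyP[xB /set0P/negP/negPn/eqP AB]]].
have /= [N _ yN] := yx _ xB.
have cS : compact (y @` `I_N) by exact/finite_compact/finite_image/finite_II.
have FS : F (y @` `I_N).
  apply: filterS (filterI FK FA) => z [[->|[k _ <-]] Az].
    have : (A `&` B) x by split => //; exact: nbhs_singleton.
    by rewrite AB.
  have [kN|Nk] := ltnP k N; first by exists k.
  have : (A `&` B) (y k) by split => //; exact: yN.
  by rewrite AB.
have [z [[k _ <-] Fz]] := cS F PF FS.
by exists (y k); split => //; right; exists k.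
Qed.

(** Points of a configuration accumulating at [x] would form, together with [x],
    a compact set containing infinitely many points of the configuration. *)
Lemma config_isolated (R : realType) (X : completePseudoMetricType R)
    (w : config X) (x : X) : hausdorff_space X ->
  exists2 A, nbhs x A & w `&` A `<=` [set x].
Proof.
move=> hX; apply: contrapT => nA.
have /choice[y yP] : forall k, exists y, [/\ points w y, y <> x &
    ball x (k.+1%:R^-1) y].
  move=> k; apply: contrapT => nk; apply: nA.
  exists (ball x k.+1%:R^-1); first exact: nbhsx_ballx.
  move=> z [wz xz]; apply: contrapT => zx; apply: nk.
  by exists z; split.
have ylim : y @ \oo --> x.
  move=> B /nbhs_ballP[r /= r0 rB].
  have [//|N] := @ltr_add_invr R 0%R r _; rewrite add0r => Nr.
  exists N => // k /= Nk; apply: rB; have [_ _] := yP k.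
  apply: le_ball; apply: le_trans (ltW Nr).
  by rewrite lef_pV2 ?posrE// ler_nat ltnS.
have finy : finite_set (range y).
  have := locally_finite w (compact_cvg_seq ylim).
  apply: sub_finite_set.
  by move=> _ [k _ <-]; split; [right; exists k|have [] := yP k].
have cly : closed (range y) by exact/(compact_closed hX)/finite_compact.
have : nbhs x (~` range y).
  apply: open_nbhs_nbhs; split; first exact: closed_openC.
  by move=> [k _ yk]; have [] := yP k.
by move=> /ylim [N _ /(_ N (leqnn _))]; apply; exists N.
Qed.

Lemma config_isolated_base (R : realType) (X : completePseudoMetricType R)
    (U : nat -> set X) (w : config X) (x : X) :
  hausdorff_space X -> base_seq U ->
  exists2 n, U n x & w `&` U n `<=` [set x].
Proof.
move=> hX [_ bU]; have [A /bU[n Ux UA] wA] := @config_isolated _ _ w x hX.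
by exists n => //; apply: subset_trans wA; exact: setIS.
Qed.

Lemma config_eq (X : ptopologicalType) (w v : config X) :
  w = v :> set X -> w = v.
Proof.
by case: w v => [w fw] [v fv] /= wv; subst v; congr Config; exact: Prop_irrelevance.
Qed.

Lemma config_delK (X : ptopologicalType) (w : config X) (x : X) :
  points w x -> config_add (config_del w x) [:: x] = w.
Proof.
move=> wx; apply: config_eq => /=; rewrite set_cons1.
apply/seteqP; split=> [y [[]//|->//]|y wy].
by have [->|yx] := pselect (y = x); [right|left; split].
Qed.

Lemma config_add_cons (X : ptopologicalType) (w : config X) (x : X) (s : seq X) :
  config_add w (x :: s) = config_add (config_add w [:: x]) s.
Proof.
apply: config_eq => /=; rewrite set_cons1 -setUA; congr (_ `|` _).
apply/seteqP; split=> y /=; rewrite inE.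
  by move=> /orP[/eqP ->|ys]; [left|right].
by move=> [->|->]; rewrite ?eqxx ?orbT.
Qed.

Lemma config_add_mem (X : ptopologicalType) (w : config X) (x : X) :
  points w x -> config_add w [:: x] = w.
Proof.
by move=> wx; apply: config_eq => /=; rewrite set_cons1 setUidl// => y ->.
Qed.

Lemma config_del_notin (X : ptopologicalType) (w : config X) (x : X) :
  ~ points w x -> config_del w x = w.
Proof.
move=> wx; apply: config_eq => /=; apply/seteqP; split=> y; first by case.
by move=> wy; split=> // yx; apply: wx; rewrite -yx.
Qed.

(** * Counting points of a configuration *)

Lemma esum_cst1_eq0 (R : realType) (T : choiceType) (A : set T) :
  \esum_(x in A) 1 = 0 :> \bar R -> A = set0.
Proof.
move=> A0; apply/seteqP; split => // x Ax.
move: A0; rewrite (esumID [set x])// [A `&` _]setIidr; last by move=> y ->.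
rewrite esum_set1// => /eqP; rewrite padde_eq0// ?onee_eq0//.
exact: esum_ge0.
Qed.

Lemma nneseries_esum_inj (R : realType) (T : choiceType) (W : set T)
    (e : T -> nat) (g : nat -> \bar R) (f : T -> \bar R) :
  {in W &, injective e} -> (forall n, 0 <= g n) ->
  (forall x, W x -> g (e x) = f x) -> (forall n, ~ (e @` W) n -> g n = 0) ->
  \sum_(n <oo) g n = \esum_(x in W) f x.
Proof.
move=> einj g0 gf gout; rewrite nneseries_esumT//.
transitivity (\esum_(n in e @` W) g n).
  rewrite [RHS]esum_mkcond; apply: eq_esum => n _.
  by case: ifPn => // /negP; rewrite inE => /gout.
by rewrite esum_image//; exact: eq_esum.
Qed.

Section config_measure_values.
Variables (R : realType) (X : ptopologicalType) (w : config X).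

Lemma config_measure_esum (A : set (borel X)) :
  config_measure R w A = \esum_(x in points w `&` A) 1.
Proof.
rewrite esum_mkcondr; apply: eq_esum => x _.
by rewrite diracE; case: ifP.
Qed.

Lemma config_measure_eq0 (A : set (borel X)) :
  config_measure R w A = 0 <-> points w `&` A = set0.
Proof.
rewrite config_measure_esum; split=> [|->]; first exact: esum_cst1_eq0.
exact: esum_set0.
Qed.

Lemma config_measure_eq1 (A : set (borel X)) :
  config_measure R w A = 1 <-> exists x, points w `&` A = [set x].
Proof.
rewrite config_measure_esum; split=> [A1|[x ->]]; last by rewrite esum_set1.
have [x wAx] : points w `&` A !=set0.
  by apply/set0P/eqP => A0; move/eqP: A1; rewrite A0 esum_set0 eq_sym onee_eq0.
exists x; apply/seteqP; split=> [y wAy|y ->//]; apply: contrapT => yx.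
move: A1; rewrite (esumID [set x])//.
rewrite [X in \esum_(_ in X) _ + _]setIidr; last by move=> z ->.
rewrite esum_set1//; set S := (X in 1 + X) => S1.
suff /esum_cst1_eq0/seteqP[/(_ y) + _] : S = 0 by apply.
case: S S1 => [r| |]// [/eqP].
by rewrite -[eqbRHS]addr0 (inj_eq (addrI _)) => /eqP ->.
Qed.

(** Once the points are numbered by an injection to [nat], the counting measure
    is a series of Dirac measures, completed by null measures. *)
Lemma integral_config_measure (h : borel X -> \bar R) : countable (points w) ->
  measurable_fun setT h -> (forall x, 0 <= h x) ->
  \int[config_measure R w]_x h x = \esum_(x in (points w : set (borel X))) h x.
Proof.
move=> /countable_injP[e einj] mh h0.
pose m n : {measure set (borel X) -> \bar R} :=
  if pselect (exists x, points w x /\ e x = n) is left ex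
  then \d_(projT1 (cid ex) : borel X) else mzero.
have mE x : points w x -> m (e x) = \d_(x : borel X).
  move=> wx; rewrite /m; case: pselect => [ex|]; last by case; exists x.
  case: cid => y [wy eyx] /=.
  by have -> : y = x by apply: einj => //; exact/mem_set.
have mout n : ~ (e @` points w) n -> m n = mzero.
  by rewrite /m; case: pselect => // -[x [wx ex]] []; exists x.
rewrite (@eq_measure_integral _ _ _ _ (mseries m 0)); last first.
  move=> A mA _; apply/esym; apply: (@nneseries_esum_inj _ _ _ e) => //.
    by move=> x wx; rewrite mE.
  by move=> n /mout ->.
rewrite ge0_integral_measure_series//; apply: (@nneseries_esum_inj _ _ _ e) => //.
- by move=> n; exact: integral_ge0.
- by move=> x wx; rewrite mE// integral_dirac// diracT mul1e.
- by move=> n /mout ->; rewrite integral_measure_zero.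
Qed.

End config_measure_values.

(** * Measurability of adding and removing a point *)

Lemma measurable_open_borel (X : ptopologicalType) (A : set X) :
  open A -> measurable (A : set (borel X)).
Proof. exact: sub_sigma_algebra. Qed.

(** A countable base of the first factor is enough: above each basic set, all the
    open sets of the second factor that fit are gathered into a single one. *)
Lemma measurable_open_prod (X Y : ptopologicalType) (U : nat -> set X)
    (W : set (X * Y)) : base_seq U -> open W ->
  measurable (W : set (borel X * borel Y)).
Proof.
move=> [oU bU] oW.
pose O n : set Y := \bigcup_(V in [set V | open V /\ U n `*` V `<=` W]) V.
have -> : W = \bigcup_n (U n `*` O n).
  apply/seteqP; split=> [[x y] Wxy|[x y] [n _ [/= Ux [V [_ UV] Vy]]]]; last first.
    exact: UV.
  have [[A B] /= [nA]] := open_nbhs_nbhs (conj oW Wxy).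
  rewrite nbhsE => -[V [oV Vy] VB] AB.
  have [n Ux UA] := bU _ _ nA; exists n => //; split => //=; exists V => //.
  split=> // -[x' y'] [/= Ux' Vy']; apply: AB; split; [exact: UA|exact: VB].
apply: bigcupT_measurable => n; apply: measurableX.
  exact: measurable_open_borel.
by apply: measurable_open_borel; apply: bigcup_open => V [].
Qed.

Lemma continuous_measurable_borel (R : realType) (X : ptopologicalType)
    (f : X -> R) : continuous f -> measurable_fun setT (f : borel X -> R).
Proof.
move=> /continuousP cf; apply: (measurability _ (RGenOpens.measurableE R)).
move=> _ [_ [a [b ->]] <-]; rewrite setTI; apply: measurable_open_borel.
by apply: cf; exact: interval_open.
Qed.

Section vague_eval_points.
Variables (R : realType) (X : completePseudoMetricType R).
Hypothesis hX : hausdorff_space X.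
Variables (U : nat -> set X).
Hypothesis bU : base_seq U.

Lemma config_countable (w : config X) : countable (points w).
Proof.
have /choice[e eP] : forall x, exists n, U n x /\ points w `&` U n `<=` [set x].
  by move=> x; have [n] := config_isolated_base w x hX bU; exists n.
apply/countable_injP; exists e => x y /set_mem wx /set_mem wy exy.
by have [Ux _] := eP x; have [_ ] := eP y; rewrite -exy; apply; split.
Qed.

Lemma esum_support_fin_num (f : X -> \bar R) (w : config X) (K : set X) :
  compact K -> (forall x, 0 <= f x) -> (forall x, f x \is a fin_num) ->
  (forall x, ~ K x -> f x = 0) -> \esum_(x in points w) f x \is a fin_num.
Proof.
move=> cK f0 ffin fK.
have -> : \esum_(x in points w) f x = \esum_(x in K `&` points w) f x.
  rewrite esum_mkcondl; apply: eq_esum => x _.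
  by case: ifPn => // /negP; rewrite inE => /fK.
have finK := locally_finite w cK.
by rewrite esum_fset// fsbig_finite//; apply/sum_fin_numP => x _ _.
Qed.

Lemma test_function_summable (w : config X) (f : test_function X) :
  \esum_(x in points w) (EFin \o sval f)^\+ x \is a fin_num /\
  \esum_(x in points w) (EFin \o sval f)^\- x \is a fin_num.
Proof.
case: f => g [cg kg] /=.
have g0 x : ~ closure [set x | g x != 0%R] x -> g x = 0%R.
  move=> ncx; apply/eqP; apply: contrapT => gx; apply: ncx.
  by apply: subset_closure; exact/negP.
have fin_max (r : R) : maxe r%:E 0 \is a fin_num by rewrite -EFin_max.
split; apply: (@esum_support_fin_num _ _ _ kg) => // x.
- by rewrite funeposE fin_max.
- by move=> /g0 gx; rewrite funeposE /= gx maxxx.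
- by rewrite funenegE -EFinN fin_max.
- by move=> /g0 gx; rewrite funenegE /= gx oppr0 maxxx.
Qed.

Lemma vague_evalE (w : config X) (f : test_function X) :
  vague_eval w f =
    (fine (\esum_(x in points w) ((EFin \o sval f)^\+ x)%E) -
     fine (\esum_(x in points w) ((EFin \o sval f)^\- x)%E))%R.
Proof.
have [finp finn] := test_function_summable w f.
case: f finp finn => g [cg kg] /= finp finn; rewrite /vague_eval /Rintegral /=.
have mg : measurable_fun setT (EFin \o g : borel X -> \bar R).
  by apply/measurable_EFinP; exact: continuous_measurable_borel.
rewrite integralE integral_config_measure//; last 2 first.
- exact: config_countable.
- exact: measurable_funepos.
rewrite integral_config_measure//; last 2 first.
- exact: config_countable.
- exact: measurable_funeneg.
by rewrite fineB.
Qed.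

Lemma vague_eval_add (w : config X) (x : X) (f : test_function X) :
  ~ points w x ->
  vague_eval (config_add w [:: x]) f = (vague_eval w f + sval f x)%R.
Proof.
move=> wx; rewrite !vague_evalE.
have esum_add (h : X -> \bar R) : (forall y, 0 <= h y) ->
    \esum_(y in points (config_add w [:: x])) h y =
    \esum_(y in points w) h y + h x.
  move=> h0; rewrite (esumID [set x])//= addeC; congr (_ + _).
    rewrite [X in esum X](_ : _ = points w)//.
    apply/seteqP; split=> y /=; rewrite inE.
      by move=> [[//|/eqP]].
    by move=> wy; split; [left|move=> yx; apply: wx; rewrite -yx].
  rewrite [X in esum X](_ : _ = [set x]) ?esum_set1//.
  by apply/seteqP; split=> y /=; [case|move=> ->; split => //; right; rewrite inE].
have [finp finn] := test_function_summable w f.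

have fin_max (r : R) : maxe r%:E 0 \is a fin_num by rewrite -EFin_max.
have maxB (r : R) : (Num.max r 0 - Num.max (- r) 0 = r)%R.
  have [r0|r0] := leP 0%R r; first by rewrite max_r ?subr0// oppr_le0.
  by rewrite max_l ?sub0r ?opprK// oppr_ge0 ltW.
rewrite !esum_add// funeposE funenegE -EFinN !fineD//= -?EFinN//.
by rewrite -!EFin_max /= opprD addrACA maxB.
Qed.

Lemma vague_eval_continuous (f : test_function X) :
  continuous (fun w : vague X => vague_eval w f : R).
Proof.
move=> w; have pf := @proj_continuous (test_function X) (fun=> R) f (vague_eval w).
apply: (@cvg_comp _ _ _ (@vague_eval R X) _ _ _ _ _ pf).
exact: initial_continuous.
Qed.

(** The sum of a test function [f] over [w] changes by [f x] when a new point
    [x] is added, and by [- f x] when a point [x] of [w] is removed.  The changed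
    value is jointly continuous in [x] and [w], and the vague topology is initial
    for these sums. *)
Lemma measurable_vague_translate (s : bool) (O : set (test_function X -> R)) :
  open (O : set {ptws test_function X -> R}) ->
  measurable [set q : borel X * Omega X |
    O (fun f => vague_eval (q.2 : config X) f + (-1) ^+ s * sval f q.1)%R].
Proof.
move=> oO; apply: (measurable_open_prod (Y := vague X) (U := U)) => //.
pose Phi (q : X * vague X) : {ptws test_function X -> R} :=
  fun f => (vague_eval (q.2 : config X) f + (-1) ^+ s * sval f q.1)%R.
suff /continuousP cPhi : continuous Phi by exact: cPhi.
move=> q; apply/cvg_sup => f A [_ [[B oB <-] Bq] BA].
apply: (filterS BA); rewrite -/(((fun p => Phi p f) @ q) B).
suff : (fun p => Phi p f) @ q --> Phi q f by apply; exact: open_nbhs_nbhs.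
apply: cvgD.
  apply: (@cvg_comp _ _ _ snd (fun w => vague_eval w f) _ (nbhs (q.2 : vague X))).
    exact: cvg_snd.
  exact: vague_eval_continuous.
apply: cvgMr; case: f {BA Bq} => g [cg _] /=.
by apply: (@cvg_comp _ _ _ fst g _ (nbhs q.1)); [exact: cvg_fst|exact: cg].
Qed.

End vague_eval_points.

Section config_maps.
Variables (R : realType) (X : completePseudoMetricType R).
Hypothesis hX : hausdorff_space X.
Variables (U : nat -> set X).
Hypothesis bU : base_seq U.
Hypothesis mcount : forall A : set (borel X), measurable A ->
  measurable_fun setT (fun w : Omega X => config_measure R w A).

Lemma measurable_config_void (A : set (borel X)) : measurable A ->
  measurable [set w : Omega X | points w `&` A = set0].
Proof.
move=> mA; rewrite (_ : [set _ | _] =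
  [set: Omega X] `&` (fun w : Omega X => config_measure R w A) @^-1` [set 0]).
  exact: mcount.
by rewrite setTI; apply/seteqP; split=> w /= /config_measure_eq0.
Qed.

Lemma measurable_config_single (A : set (borel X)) : measurable A ->
  measurable [set w : Omega X | exists x, points w `&` A = [set x]].
Proof.
move=> mA; rewrite (_ : [set _ | _] =
  [set: Omega X] `&` (fun w : Omega X => config_measure R w A) @^-1` [set 1]).
  exact: mcount.
by rewrite setTI; apply/seteqP; split=> w /= /config_measure_eq1.
Qed.

(** A point outside [w] has a basic neighbourhood that misses the closed set
    [w]. *)
Lemma config_off_diagonalE :
  [set q : borel X * Omega X | ~ points q.2 q.1] =
  \bigcup_n (U n `*` [set w : Omega X | points w `&` U n = set0]).
Proof.
apply/seteqP; split=> [[x w] /= nwx|[x w] [n _ [/= Ux wU] wx]]; last first.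
  by have : (points w `&` U n) x by []; rewrite wU.
have [n Ux wU] := config_isolated_base w x hX bU.
exists n => //; split => //=; apply/seteqP; split=> // y wUy.
by have /= yx := wU _ wUy; apply: nwx; rewrite -yx; case: wUy.
Qed.

Lemma measurable_base (n : nat) : measurable (U n : set (borel X)).
Proof. by apply: measurable_open_borel; case: bU => oU _; exact: oU. Qed.

Lemma measurable_diagonal :
  measurable [set q : borel X * Omega X | points q.2 q.1].
Proof.
rewrite -[X in measurable X]setCK; apply: measurableC.
rewrite (_ : ~` _ = [set q : borel X * Omega X | ~ points q.2 q.1])//.
rewrite config_off_diagonalE; apply: bigcupT_measurable => n; apply: measurableX.
  exact: measurable_base.
by apply: (@measurable_config_void (U n)); exact: measurable_base.
Qed.

Lemma measurable_config_add1 : measurable_fun setT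
  (fun q : borel X * Omega X => config_add q.2 [:: q.1] : Omega X).
Proof.
apply: (@measurability _ _ _ (Omega X) _ _ (@open (vague X)) erefl) => _ [_ [V oV <-] <-].
rewrite setTI.
have mD := measurable_diagonal.
rewrite (_ : _ @^-1` _ =
  ([set q | points q.2 q.1] `&` (snd @^-1` (@vague_eval R X @^-1` V))) `|`
  (~` [set q | points q.2 q.1] `&` [set q : borel X * Omega X |
    V (fun f => vague_eval (q.2 : config X) f + (-1) ^+ false * sval f q.1)%R])).
  apply: measurableU; apply: measurableI => //.
  - rewrite -[X in measurable X]setTI; apply: measurable_snd => //.
    by apply: sub_sigma_algebra; exists V.
  - exact: measurableC.
  - exact: (measurable_vague_translate bU).
apply/seteqP; split=> -[x w] /=.
  have [wx|wx] := pselect (points w x); first by rewrite config_add_mem//; left.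
  move=> Vw; right; split=> //; rewrite [X in V X](_ : _ = vague_eval (config_add w [:: x]))//.
  by apply/funext => f; rewrite expr0 mul1r (vague_eval_add hX bU).
move=> [[wx]|[wx]]; first by rewrite config_add_mem.
rewrite [X in V X](_ : _ = vague_eval (config_add w [:: x]))//.
by apply/funext => f; rewrite expr0 mul1r (vague_eval_add hX bU).
Qed.

Lemma measurable_config_del : measurable_fun setT
  (fun q : borel X * Omega X => config_del q.2 q.1 : Omega X).
Proof.
apply: (@measurability _ _ _ (Omega X) _ _ (@open (vague X)) erefl) => _ [_ [V oV <-] <-].
rewrite setTI.
have mD := measurable_diagonal.
rewrite (_ : _ @^-1` _ =
  (~` [set q | points q.2 q.1] `&` (snd @^-1` (@vague_eval R X @^-1` V))) `|`
  ([set q | points q.2 q.1] `&` [set q : borel X * Omega X |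
    V (fun f => vague_eval (q.2 : config X) f + (-1) ^+ true * sval f q.1)%R])).
  apply: measurableU; apply: measurableI => //.
  - exact: measurableC.
  - rewrite -[X in measurable X]setTI; apply: measurable_snd => //.
    by apply: sub_sigma_algebra; exists V.
  - exact: (measurable_vague_translate bU).
have delE (x : X) (w : config X) : points w x ->
    (fun f => vague_eval w f + (-1) ^+ true * sval f x)%R =
    vague_eval (config_del w x).
  move=> wx; apply/funext => f; rewrite -{1}(config_delK wx).
  rewrite (vague_eval_add hX bU); last by move=> [_]; apply.
  by rewrite expr1 mulN1r addrK.
apply/seteqP; split=> -[x w] /=.
  have [wx|wx] := pselect (points w x); last by rewrite config_del_notin//; left.
  by move=> Vw; right; split=> //; rewrite delE.
move=> [[wx]|[wx]]; first by rewrite config_del_notin.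
by rewrite delE.
Qed.

End config_maps.

(** * Measurable enumeration of the points *)

(** The [n]-th label is in use on the event [D n] only, since configurations may
    be finite. *)
Definition measurable_enumeration (R : realType) (X : completePseudoMetricType R)
    (D : nat -> set (Omega X)) (p : nat -> Omega X -> borel X) : Prop :=
  [/\ forall n, measurable (D n), forall n, measurable_fun setT (p n) &
      forall w : Omega X, set_bij [set n | D n w] (points w : set (borel X))
                                  (p ^~ w)].

Section enumeration.
Variables (R : realType) (X : completePseudoMetricType R).
Hypothesis hX : hausdorff_space X.
Hypothesis mcount : forall A : set (borel X), measurable A ->
  measurable_fun setT (fun w : Omega X => config_measure R w A).

(** The label of a point is the first index of a basic set that isolates it
    within the configuration. *)
Lemma measurable_enumeration_exists (U : nat -> set X) : base_seq U ->
  exists D p, @measurable_enumeration R X D p.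
Proof.
move=> bU.
pose S (A : set X) : set (Omega X) := [set w | exists x, points w `&` A = [set x]].
have mS (A : set (borel X)) : measurable A -> measurable (S A).
  exact: (measurable_config_single mcount).
have mU n : measurable (U n : set (borel X)) by exact: measurable_base.
(* With [U n] and [U k] both isolating a point, [S (U n `&` U k)] says that it
   is the same point; then the smaller label is kept. *)
pose D n := S (U n) `&` \bigcap_(k in `I_n) ~` (S (U k) `&` S (U n `&` U k)).
pose p n (w : Omega X) : borel X :=
  if pselect (S (U n) w) is left wU then projT1 (cid wU) else point.
have pE n (w : config X) x : points w `&` U n = [set x] -> p n w = x.
  move=> wU; rewrite /p; case: pselect => [wU'|]; last by case; exists x.
  by case: cid => y /=; rewrite wU => /seteqP[_ /(_ y erefl)] /= ->.
exists D, p; split.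
- move=> n; apply: measurableI; first exact: mS.
  apply: bigcap_measurableType => k _; apply: measurableC.
  by apply: measurableI; apply: mS => //; exact: measurableI.
- move=> n _ Y mY; rewrite setTI.
  rewrite (_ : _ @^-1` _ = (S (U n) `&` S (U n `&` Y)) `|`
      (~` S (U n) `&` (if pselect (Y point) then setT else set0))).
    apply: measurableU; apply: measurableI.
    + exact: mS.
    + by apply: mS; exact: measurableI.
    + by apply: measurableC; exact: mS.
    + by case: pselect => ?; [exact: measurableT|exact: measurable0].
  apply/seteqP; split=> w /=.
    have [[x wU]|nS] := pselect (S (U n) w).
      rewrite (pE _ _ _ wU) => Yx; left; split; first by exists x.
      by exists x; rewrite setIA wU; apply/seteqP; split=> [y []//|y ->].
    by rewrite {1}/p; case: pselect => // _ Yp; right; split=> //; case: pselect.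
  move=> [[[x wU] [y]]|[nS]].
    rewrite setIA wU => /seteqP[_ /(_ y erefl)] /= [yx Yy].
    by rewrite (pE _ _ _ wU) -yx.
  by rewrite /p; case: pselect => // ?; case: pselect.
- move=> w; split.
  + move=> n [[x wU] _]; rewrite (pE _ _ _ wU).
    by have [] : (points w `&` U n) x by rewrite wU.
  + have wlt n k : D n w -> D k w -> (k < n)%N -> p n w <> p k w.
      move=> [[x wUn] wn] [[y wUk] _] kn.
      rewrite (pE _ _ _ wUn) (pE _ _ _ wUk) => xy.
      have /= := wn k kn; apply; split; first by exists y.
      exists x; rewrite setIA wUn; apply/seteqP; split=> [z []//|z ->]; split=> //.
      by rewrite xy; have [] : (points w `&` U k) y by rewrite wUk.
    move=> n k /set_mem Dn /set_mem Dk pnk; case: (ltngtP n k) => // nk.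
      by have := wlt _ _ Dk Dn nk; rewrite pnk.
    by have := wlt _ _ Dn Dk nk.
  + move=> x wx.
    have exn : exists n, `[< points w `&` U n = [set x] >].
      have [n Ux wU] := config_isolated_base w x hX bU.
      by exists n; apply/asboolP/seteqP; split=> // y ->.
    case: (ex_minnP exn) => n /asboolP wU nmin.
    exists n; last exact: pE.
    split; first by exists x.
    move=> k kn [[y wk] [z wnk]].
    have [zx Ukz] : ([set x] `&` U k) z by rewrite -wU -setIA wnk.
    rewrite /= in zx; subst z.
    have xy : x = y by have : (points w `&` U k) x by []; rewrite wk.
    suff : (n <= k)%N by rewrite leqNgt kn.
    by apply: nmin; apply/asboolP; rewrite wk xy.
Qed.

End enumeration.

Section enumerated_sums.
Variables (R : realType) (X : completePseudoMetricType R).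
Variables (D : nat -> set (Omega X)) (p : nat -> Omega X -> borel X).
Hypothesis Dp : measurable_enumeration D p.

Lemma esum_enumeration (w : Omega X) (h : X -> \bar R) : (forall x, 0 <= h x) ->
  \esum_(x in points w) h x = \sum_(n <oo) (\1_(D n) w)%:E * h (p n w).
Proof.
move=> h0; have [_ _ /(_ w) bij] := Dp.
rewrite nneseries_esumT; last by move=> n; rewrite mule_ge0// lee_fin.
rewrite (@reindex_esum _ _ _ _ _ _ h bij).
rewrite esum_mkcond; apply: eq_esum => n _; rewrite indicE.
case: ifPn => [/set_mem|/negP] Dn; first by rewrite mem_set// mul1e.
by rewrite memNset ?mul0e// => Dw; apply: Dn; exact/mem_set.
Qed.

Lemma measurable_esum_config d (T : measurableType d) (phi : T -> Omega X)
    (h : T -> X -> \bar R) :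
  measurable_fun setT phi -> (forall t x, 0 <= h t x) ->
  measurable_fun setT (fun q : T * borel X => h q.1 q.2) ->
  measurable_fun setT (fun t => \esum_(x in points (phi t)) h t x).
Proof.
move=> mphi h0 mh; have [mD mp _] := Dp.
under [X in measurable_fun _ X]eq_fun do rewrite esum_enumeration//.
rewrite (_ : (fun _ => _) = (fun t => \sum_(n <oo | n \in xpredT)
    (\1_(D n) (phi t))%:E * h t (p n (phi t))))//.
apply: ge0_emeasurable_sum => [n t _ _|n _]; first by rewrite mule_ge0// lee_fin.
apply: emeasurable_funM.
  apply/measurable_EFinP; apply: (measurableT_comp _ mphi).
  exact: measurable_indic.
exact: (measurableT_comp mh
  (measurable_fun_pair (@measurable_id _ _ _) (measurableT_comp (mp n) mphi))).
Qed.

End enumerated_sums.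

(** * Sums over tuples *)

Lemma ge0_esumZl (R : realType) (T : choiceType) (W : set T) (r : \bar R)
    (f : T -> \bar R) : 0 <= r -> (forall x, 0 <= f x) ->
  \esum_(x in W) (r * f x) = r * \esum_(x in W) f x.
Proof.
move=> r0 f0; case: r r0 => [r| |]//; last first.
  move=> _; have [[x Wx fx]|nf] := pselect (exists2 x, W x & 0 < f x).
    have sub1 (g : T -> \bar R) : (forall x, 0 <= g x) -> g x <= \esum_(x in W) g x.
      move=> g0; rewrite -(esum_set1 (t := x))//.
      by rewrite [leRHS](esumID [set x])// setIidr ?leeDl ?esum_ge0// => y ->.
    rewrite gt0_mulye; last exact: lt_le_trans fx (sub1 _ f0).
    apply/eqP; rewrite -leye_eq.
    have := sub1 (fun y => +oo * f y); rewrite gt0_mulye//; apply => y.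
    by rewrite mule_ge0// leey.
  have fW0 x : W x -> f x = 0.
    move=> Wx; apply/eqP; rewrite eq_le f0 andbT leNgt; apply/negP => fx.
    by apply: nf; exists x.
  by rewrite !esum1 ?mule0// => x /fW0 ->; rewrite mule0.
rewrite lee_fin le_eqVlt => /predU1P[<-|r0].
  by rewrite mul0e esum1// => x _; rewrite mul0e.
rewrite /esum -ereal_sup_pZl//; congr ereal_sup; apply/seteqP; split.
  move=> _ [A WA <-]; exists (\sum_(x \in A) f x); first by exists A.
  by rewrite ge0_mule_fsumr.
by move=> _ [_ [A WA <-] <-]; exists A => //; rewrite ge0_mule_fsumr.
Qed.

Definition tuples_in (T : choiceType) (W : set T) (m : nat) : set (m.-tuple T) :=
  [set z | forall x, x \in z -> W x].
Arguments tuples_in {T} W m _.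

Lemma tuples_in_cons (T : choiceType) (W : set T) (m : nat) (x : T)
    (s : m.-tuple T) :
  tuples_in W m.+1 [tuple of x :: s] <-> W x /\ tuples_in W m s.
Proof.
split=> [Wz|[Wx Ws] y].
  by split=> [|y ys]; apply: Wz; rewrite inE ?eqxx// ys orbT.
by rewrite inE => /predU1P[->//|/Ws].
Qed.

Lemma esum_tuple0 (R : realType) (T : choiceType) (Z : set (0.-tuple T))
    (f : 0.-tuple T -> \bar R) : Z [tuple] -> 0 <= f [tuple] ->
  \esum_(z in Z) f z = f [tuple].
Proof.
move=> Z0 f0; rewrite (_ : Z = [set [tuple]]) ?esum_set1//.
by apply/seteqP; split=> z; rewrite (tuple0 z).
Qed.

Lemma esum_tuple_head (R : realType) (T : choiceType) (W : set T) (m : nat)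
    (f : m.+1.-tuple T -> \bar R) : (forall z, 0 <= f z) ->
  \esum_(z in tuples_in W m.+1) f z =
  \esum_(x in W) \esum_(s in tuples_in W m) f [tuple of x :: s].
Proof.
move=> f0; rewrite esum_esum//.
apply: (@reindex_esum _ _ _ _ _ (fun q : T * m.-tuple T => [tuple of q.1 :: q.2])); split.
- by move=> [x s] [/= Wx Ws]; apply/tuples_in_cons.
- by move=> [x s] [y t] _ _ /(congr1 val) /= [xy st]; congr pair => //; exact: val_inj.
- by case/tupleP=> x s /tuples_in_cons Wxs; exists (x, s).
Qed.

Lemma esum_uniq_tuple_tail (R : realType) (T : choiceType) (W : set T) (m : nat)
    (f : m.+1.-tuple T -> \bar R) : (forall z, 0 <= f z) ->
  \esum_(z in tuples_in W m.+1 `&` [set z | uniq z]) f z =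
  \esum_(s in tuples_in W m `&` [set s | uniq s])
    \esum_(x in W `\` [set` s]) f [tuple of x :: s].
Proof.
move=> f0; rewrite esum_esum//.
apply: (@reindex_esum _ _ _ _ _ (fun q : m.-tuple T * T => [tuple of q.2 :: q.1])); split.
- move=> [s x] [/= [Ws us] [Wx xs]]; split; first exact/tuples_in_cons.
  by rewrite /= us andbT; exact/negP.
- by move=> [x s] [y t] _ _ /(congr1 val) /= [xy st]; congr pair => //; exact: val_inj.
- case/tupleP=> x s [/tuples_in_cons[Wx Ws]] /= /andP[/negP xs us].
  by exists (s, x).
Qed.

Lemma prode_esum (R : realType) (T : choiceType) (W : set T) (n : nat)
    (F : 'I_n -> T -> \bar R) : (forall k x, 0 <= F k x) ->
  \prod_(k < n) (\esum_(x in W) F k x) =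
  \esum_(t in tuples_in W n) \prod_(k < n) F k (tnth t k).
Proof.
elim: n F => [|n IHn] F F0.
  by rewrite big_ord0 esum_tuple0// big_ord0.
rewrite big_ord_recl IHn// esum_tuple_head; last by move=> z; exact: prode_ge0.
rewrite muleC -ge0_esumZl//; last by apply: esum_ge0 => t _; exact: prode_ge0.
apply: eq_esum => x _; rewrite muleC -ge0_esumZl//; last first.
  by move=> t; exact: prode_ge0.
apply: eq_esum => t _; rewrite big_ord_recl /= tnth0; congr (_ * _).
by apply: eq_bigr => k _; rewrite tnthS.
Qed.

(** * Families of points and the partition of their coincidences *)

Section kernel_partition.
Variables (T : choiceType) (n r : nat).

Definition entry (t : n.-tuple (r.-tuple T)) (a : 'I_n * 'I_r) : T :=
  tnth (tnth t a.1) a.2.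

Definition kernel_partition (t : n.-tuple (r.-tuple T)) : partitions n r :=
  exist _ (finset.preim_partition (entry t) [set: 'I_n * 'I_r]%SET)
          (finset.preim_partitionP (entry t) _).

Lemma kernel_pblock (t : n.-tuple (r.-tuple T)) (a b : 'I_n * 'I_r) :
  (b \in finset.pblock (val (kernel_partition t)) a) = (entry t a == entry t b).
Proof.
apply: finset.pblock_equivalence_partition; rewrite ?finset.in_setT//.
by split=> // /eqP ->.
Qed.

Variable rho : partitions n r.

Lemma enum_val_zeta (a : 'I_n * 'I_r) :
  enum_val (zeta rho a) = finset.pblock (val rho) a.
Proof. by rewrite enum_rankK_in// pblock_in_partition. Qed.

Lemma zeta_eq (a b : 'I_n * 'I_r) :
  (zeta rho a == zeta rho b) = (b \in finset.pblock (val rho) a).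
Proof.
rewrite -(inj_eq enum_val_inj) !enum_val_zeta finset.eq_pblock//.
  exact: finset.partition_trivIset (valP rho).
by rewrite (finset.cover_partition (valP rho)) finset.in_setT.
Qed.

Lemma zeta_surj (p : 'I_#|val rho|) : exists a, zeta rho a = p.
Proof.
have /finset.set0Pn[a ap] : enum_val p != finset.set0.
  apply: contraTneq (enum_valP p) => ->.
  by have /and3P[] := valP rho.
by exists a; apply/zetaP.
Qed.

Definition selection (z : #|val rho|.-tuple T) : n.-tuple (r.-tuple T) :=
  [tuple select z k | k < n].

Lemma entry_selection (z : #|val rho|.-tuple T) (a : 'I_n * 'I_r) :
  entry (selection z) a = tnth z (zeta rho a).
Proof. by case: a => k l; rewrite /entry !tnth_mktuple. Qed.

Lemma kernel_selection (z : #|val rho|.-tuple T) : uniq z ->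
  kernel_partition (selection z) = rho.
Proof.
move=> uz; apply: val_inj => /=.
rewrite -[RHS](finset.equivalence_partition_pblock (valP rho)).
apply: finset.eq_imset => a; apply/finset.setP => b; rewrite !finset.inE /=.
by rewrite !entry_selection -zeta_eq; rewrite (inj_eq (tuple_uniqP _ uz)).
Qed.

(** A family of points indexed by the cells [(k, l)] amounts to the partition of
    the cells into the classes carrying equal points, together with the tuple of
    the distinct points carried by the classes. *)
Lemma selection_bij (W : set T) :
  set_bij (tuples_in W #|val rho| `&` [set z | uniq z])
    (tuples_in (tuples_in W r) n `&` [set t | kernel_partition t == rho])
    selection.
Proof.
split.
- move=> z [Wz uz]; split=> /=; last by rewrite kernel_selection.
  move=> s /tnthP[k ->] x /tnthP[l ->].
  by rewrite !tnth_mktuple; apply: Wz; exact: mem_tnth.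
- move=> z z' _ _ ezz'; apply: eq_from_tnth => p.
  by have [a <-] := zeta_surj p; rewrite -!entry_selection ezz'.
- move=> t [Wt /eqP krho].
  have /choice[rep repE] := zeta_surj.
  have zetaE a b : (zeta rho a == zeta rho b) = (entry t a == entry t b).
    by rewrite zeta_eq -krho kernel_pblock.
  exists [tuple entry t (rep p) | p < #|val rho|].
    split.
      move=> _ /tnthP[p ->]; rewrite tnth_mktuple /entry.
      by apply: (Wt (tnth t (rep p).1)); exact: mem_tnth.
    apply/tuple_uniqP => p q; rewrite !tnth_mktuple => /eqP.
    by rewrite -zetaE !repE => /eqP.
  apply: eq_from_tnth => k; apply: eq_from_tnth => l.
  rewrite -[LHS]/(entry _ (k, l)) entry_selection tnth_mktuple.
  by apply/eqP; rewrite -[X in _ == X]/(entry t (k, l)) -zetaE repE.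
Qed.

End kernel_partition.

Lemma esum_partitions (R : realType) (T : choiceType) (n r : nat) (W : set T)
    (g : n.-tuple (r.-tuple T) -> \bar R) : (forall t, 0 <= g t) ->
  \esum_(t in tuples_in (tuples_in W r) n) g t =
  \sum_(rho : partitions n r)
    \esum_(z in tuples_in W #|val rho| `&` [set z | uniq z]) g (selection z).
Proof.
move=> g0; transitivity (\esum_(t in tuples_in (tuples_in W r) n)
    \sum_(rho : partitions n r) if kernel_partition t == rho then g t else 0).
  apply: eq_esum => t _; rewrite (bigD1 (kernel_partition t))//= eqxx.
  by rewrite big1 ?adde0// => rho /negPf; rewrite eq_sym => ->.
rewrite esum_sum; last by move=> t rho _ _; case: ifP.
apply: eq_bigr => rho _; rewrite -(@reindex_esum _ _ _ _ _ _ g (selection_bij rho W)).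
rewrite esum_mkcondr; apply: eq_esum => t _.
by case: ifPn => kt; [rewrite mem_set|rewrite memNset//; exact/negP].
Qed.

(** * Powers of sigma-finite measures *)

Lemma measurable_cons_pair d (T : measurableType d) (m : nat) :
  measurable_fun setT (fun q : T * m.-tuple T => [tuple of q.1 :: q.2]).
Proof. exact: measurable_cons. Qed.

Lemma sigma_finite_pack d (T : measurableType d) (R : realType)
    (mu : {measure set T -> \bar R}) : sigma_finite setT mu ->
  exists nu : {sigma_finite_measure set T -> \bar R},
    (mu : set T -> \bar R) = nu.
Proof.
move=> smu.
have sf := sfinite_measure_sigma_finite smu.
pose B1 := isSFinite.Build d T R mu sf.
pose B2 := isSigmaFinite.Build d T R mu smu.
pose nu : {sigma_finite_measure set T -> \bar R} :=
  HB.pack_for (SigmaFiniteMeasure.type T R) (Measure.sort mu) B1 B2.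
by exists nu.
Qed.

Section power_measure_theory.
Context d (T : measurableType d) (R : realType).
Variable mu : {sigma_finite_measure set T -> \bar R}.

(** The iterated product is defined on bare set functions; having it as a
    sigma-finite measure gives access to the Tonelli theorem. *)
Lemma power_measure_sigma_finite (m : nat) :
  exists nu : {sigma_finite_measure set (m.-tuple T) -> \bar R},
    power_measure mu m = nu.
Proof.
elim: m => [|m [nu IHm]]; first by exists (dirac [tuple]).
rewrite /= -/(power_measure mu m) IHm.
pose cons_pair (q : T * m.-tuple T) := [tuple of q.1 :: q.2].
have mc : measurable_fun setT cons_pair by exact: measurable_cons_pair.
pose uncons (z : m.+1.-tuple T) : T * m.-tuple T := (thead z, [tuple of behead z]).
have mu1 : measurable_fun setT uncons.
  by apply: measurable_fun_pair; [exact: measurable_tnth|exact: measurable_behead].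
(* The measure structure of an image depends on a proof that the map is
   measurable, which inference cannot find. *)
pose k mc' : {measure set (m.+1.-tuple T) -> \bar R} :=
  @measure_function_pushforward__canonical__measure_function_Measure
    _ _ _ _ _ (mu \x nu) cons_pair mc'.
have [|nu' ?] := @sigma_finite_pack _ _ _ (k mc); last by exists nu'.
have /sigma_finiteP[F [F_T ndF Foo]] := sigma_finiteT mu.
have /sigma_finiteP[G [G_T ndG Goo]] := sigma_finiteT nu.
exists (fun i => uncons @^-1` (F i `*` G i)).
  apply/seteqP; split=> // z _.
  have [i _ Fz] : (\bigcup_i F i) (uncons z).1 by rewrite -F_T.
  have [j _ Gz] : (\bigcup_i G i) (uncons z).2 by rewrite -G_T.
  exists (maxn i j) => //; split.
    by apply: (subsetPset _ _ (ndF _ _ (leq_maxl i j))).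
  by apply: (subsetPset _ _ (ndG _ _ (leq_maxr i j))).
move=> i; have [mF Fi] := Foo i; have [mG Gi] := Goo i; split.
  by rewrite -[X in measurable X]setTI; apply: mu1 => //; exact: measurableX.
rewrite /k /= /pushforward (_ : _ @^-1` _ = F i `*` G i); last first.
  apply/seteqP; split=> -[x s]; rewrite /uncons /= theadE.
    by rewrite [X in G i X](_ : _ = s)//; exact: val_inj.
  by rewrite [X in _ -> _ /\ G i X](_ : _ = s)//; exact: val_inj.
by rewrite product_measure1E// lte_mul_pinfty// ge0_fin_numE.
Qed.

Lemma integral_power_measure0 (f : 0.-tuple T -> \bar R) :
  measurable_fun setT f -> \int[power_measure mu 0]_z f z = f [tuple].
Proof. by move=> mf; rewrite integral_dirac// diracT mul1e. Qed.

Lemma integral_power_measureS (m : nat) (f : m.+1.-tuple T -> \bar R) :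
  measurable_fun setT f -> (forall z, 0 <= f z) ->
  \int[power_measure mu m.+1]_z f z =
  \int[mu]_x \int[power_measure mu m]_s f [tuple of x :: s].
Proof.
move=> mf f0; rewrite /= -/(power_measure mu m).
have [nu ->] := power_measure_sigma_finite m.
rewrite ge0_integral_pushforward//; last exact: measurable_cons_pair.
rewrite preimage_setT (fubini_tonelli1 (f \o _))//; last first.
  by move=> q; exact: f0.
exact: (measurableT_comp mf (@measurable_cons_pair _ _ m)).
Qed.

Lemma measurable_integral_power_measure d' (Y : measurableType d') (m : nat)
    (f : Y -> m.-tuple T -> \bar R) :
  measurable_fun setT (fun q : Y * m.-tuple T => f q.1 q.2) ->
  (forall y z, 0 <= f y z) ->
  measurable_fun setT (fun y => \int[power_measure mu m]_z f y z).
Proof.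
move=> mf f0; have [nu ->] := power_measure_sigma_finite m.
exact: (@measurable_fun_fubini_tonelli_F _ _ _ _ _ nu _ mf).
Qed.

End power_measure_theory.

Section config_power.
Variables (R : realType) (X : completePseudoMetricType R).
Hypothesis hX : hausdorff_space X.
Variables (U : nat -> set X).
Hypothesis bU : base_seq U.

Lemma config_measure_sigma_finite (w : config X) :
  exists nu : {sigma_finite_measure set (borel X) -> \bar R},
    (config_measure R w : set (borel X) -> \bar R) = nu.
Proof.
apply: sigma_finite_pack.
exists (fun n => if pselect (config_measure R w (U n) < +oo) then U n else set0).
  apply/seteqP; split=> // x _.
  have [n Ux wU] := config_isolated_base w x hX bU.
  exists n => //; case: pselect => //; case; rewrite config_measure_esum.
  have [wx|wx] := pselect (points w x).
    rewrite (_ : _ `&` _ = [set x]) ?esum_set1 ?ltry//.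
    by apply/seteqP; split=> // y ->.
  rewrite (_ : _ `&` _ = set0) ?esum_set0 ?ltry//.
  apply/seteqP; split=> // y wUy; have yx := wU _ wUy.
  by case: wUy; rewrite yx.
move=> n; case: pselect => /= [wU|_]; last by rewrite measure0.
by split=> //; exact: (measurable_base bU).
Qed.

Lemma integral_power_config_measure (w : config X) (m : nat)
    (f : m.-tuple (borel X) -> \bar R) :
  measurable_fun setT f -> (forall z, 0 <= f z) ->
  \int[power_measure (config_measure R w) m]_z f z =
  \esum_(z in tuples_in (points w : set (borel X)) m) f z.
Proof.
have [nu nuE] := config_measure_sigma_finite w.
elim: m f => [|m IHm] f mf f0.
  by rewrite nuE integral_power_measure0// esum_tuple0.
have mfx x : measurable_fun setT (fun s : m.-tuple _ => f [tuple of x :: s]).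
  exact: (measurableT_comp mf (measurable_cons _ _)).
rewrite nuE integral_power_measureS// -nuE esum_tuple_head//.
under eq_integral do rewrite IHm//.
apply: integral_config_measure.
- exact: (config_countable hX bU).
- apply: (eq_measurable_fun (fun x => \int[power_measure nu m]_s f [tuple of x :: s])).
    by move=> x _; rewrite -nuE IHm.
  apply: measurable_integral_power_measure => //.
  exact: (measurableT_comp mf (@measurable_cons_pair _ _ m)).
- by move=> x; exact: esum_ge0.
Qed.

End config_power.

(** * Measures with a density *)

Section density.
Context d (T : measurableType d) (R : realType).
Variables (mu : {measure set T -> \bar R}) (a : T -> \bar R).
Hypotheses (ma : measurable_fun setT a) (a0 : forall x, 0 <= a x).

(** Monotonicity makes multiplication by [b = +oo] continuous along [u]: either
    [u] vanishes identically or the products are eventually [+oo]. *)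
Lemma cvg_nondecreasing_mule (u : (\bar R)^nat) (l b : \bar R) :
  nondecreasing_seq u -> (forall n, 0 <= u n) -> 0 <= b ->
  u @ \oo --> l -> (u n * b @[n --> \oo]) --> l * b.
Proof.
move=> ndu u0 b0 ul.
have ule n : u n <= l.
  rewrite -(cvg_lim _ ul)//; apply: lime_ge; first exact: cvgP ul.
  by exists n => // k; exact: ndu.
have l0 : 0 <= l by exact: le_trans (u0 0%N) (ule 0%N).
have [bfin|] := boolP (b \is a fin_num); first exact: cvgeZr.
rewrite ge0_fin_numE// -leNgt leye_eq => /eqP ->.
have [l00|lp] := eqVneq l 0.
  rewrite l00 mul0e; apply: cvg_near_cst; apply: nearW => n.
  by have -> : u n = 0; [apply/eqP; rewrite eq_le u0 -l00 ule|rewrite mul0e].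
have {lp}lp : 0 < l by rewrite lt_neqAle eq_sym lp.
rewrite gt0_muley//; apply: cvg_near_cst.
have [N uN] : exists N, 0 < u N.
  apply: contrapT => /forallNP uN; suff : l <= 0 by rewrite leNgt lp.
  rewrite -(cvg_lim _ ul)//; apply: lime_le; first exact: cvgP ul.
  by apply: nearW => n; rewrite leNgt; exact/negP.
exists N => // n /= Nn; rewrite gt0_muley//.
exact: lt_le_trans uN (ndu _ _ Nn).
Qed.

Import HBNNSimple.

(** The density may take the value [+oo] on a set of positive measure, so the
    measure obtained need not be sigma-finite. *)
Lemma density_measure : exists m : {measure set T -> \bar R},
  (forall S, measurable S -> m S = \int[mu]_(x in S) a x) /\
  forall h, measurable_fun setT h -> (forall x, 0 <= h x) ->
    \int[m]_x h x = \int[mu]_x (h x * a x).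
Proof.
pose dens S := \int[mu]_(x in S) a x.
have dens0 : dens set0 = 0 by rewrite /dens integral_set0.
have dens_ge0 S : 0 <= dens S by exact: integral_ge0.
have dens_sigma : semi_sigma_additive dens.
  move=> F mF tF mUF; rewrite /dens ge0_integral_bigcup//; last first.
    exact: measurable_funTS.
  by apply: is_cvg_nneseries => n _ _; exact: dens_ge0.
pose m : {measure set T -> \bar R} := HB.pack_for (Measure.type T R) dens
  (isMeasure.Build _ _ _ dens dens0 dens_ge0 dens_sigma).
exists m; split=> // h mh h0.
pose f := nnsfun_approx measurableT mh.
have fh x : (f n x)%:E @[n --> \oo] --> h x by exact: cvg_nnsfun_approx.
have ndf x : nondecreasing_seq (fun n => (f n x)%:E).
  by move=> i j ij; rewrite lee_fin; exact/lefP/nd_nnsfun_approx.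
have mf n : measurable_fun setT (fun x => (f n x)%:E) by exact/measurable_EFinP.
have f0 n x : 0 <= (f n x)%:E by rewrite lee_fin.
have lim_m : \int[m]_x (f n x)%:E @[n --> \oo] --> \int[m]_x h x.
  under [X in _ --> X]eq_integral do rewrite -(cvg_lim _ (fh _))//.
  exact: cvg_monotone_convergence.
have lim_mu : \int[mu]_x ((f n x)%:E * a x) @[n --> \oo] --> \int[mu]_x (h x * a x).
  have fah x : (f n x)%:E * a x @[n --> \oo] --> h x * a x.
    exact: cvg_nondecreasing_mule.
  under [X in _ --> X]eq_integral do rewrite -(cvg_lim _ (fah _))//.
  apply: cvg_monotone_convergence => //.
  - by move=> n; exact: emeasurable_funM.
  - by move=> n x _; rewrite mule_ge0.
  - by move=> x _ i j ij; rewrite lee_wpmul2r//; exact: ndf.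
rewrite -(cvg_lim _ lim_m)// -(cvg_lim _ lim_mu)//; congr (lim (_ @ \oo)).
apply/funext => n.
transitivity (\int[m]_x (\sum_(y \in range (f n))
    (y%:E * (\1_(f n @^-1` [set y]) x)%:E))).
  apply: eq_integral => x _; by rewrite fimfunE -fsumEFin.
have mI y : measurable_fun setT (fun x => (\1_(f n @^-1` [set y]) x)%:E : \bar R).
  by apply/measurable_EFinP; exact: measurable_indic.
have yI0 y x : 0 <= y%:E * (\1_(f n @^-1` [set y]) x)%:E :> \bar R.
  by rewrite -EFinM; exact: nnfun_muleindic_ge0.
rewrite ge0_integral_fsum//; last by move=> y; exact: measurable_funeM.
transitivity (\int[mu]_x (\sum_(y \in range (f n))
    (y%:E * (\1_(f n @^-1` [set y]) x)%:E * a x))); last first.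
  apply: eq_integral => x _; rewrite -ge0_mule_fsuml//.
  by congr (_ * _); rewrite fimfunE -fsumEFin.
rewrite ge0_integral_fsum//; last 2 first.
- by move=> y; apply: emeasurable_funM => //; exact: measurable_funeM.
- by move=> y x _; rewrite mule_ge0.
apply: eq_fsbigr => y /set_mem[x0 _ <-].
rewrite ge0_integralZl ?lee_fin//.
under [RHS]eq_integral do rewrite -muleA.
rewrite ge0_integralZl ?lee_fin//; last 2 first.
- by apply: emeasurable_funM.
- by move=> x _; rewrite mule_ge0.
congr (_ * _); rewrite integral_indic// setIT /=.
rewrite /dens integral_mkcond; apply: eq_integral => x _.
by rewrite epatch_indic muleC.
Qed.

End density.

(** * The Georgii-Nguyen-Zessin formula *)

(** The rectangles of finite measure have to cover the space up to a null set
    only; uniqueness is applied inside each of them, and the pieces are glued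
    along a disjoint refinement. *)
Lemma measure_eq_rectangles d1 d2 (T1 : measurableType d1) (T2 : measurableType d2)
    (R : realType) (m1 m2 : {measure set (T1 * T2) -> \bar R})
    (A : nat -> set T1) (B : nat -> set T2) :
  (forall n, measurable (A n)) -> (forall n, measurable (B n)) ->
  (forall A' B', measurable A' -> measurable B' -> m1 (A' `*` B') = m2 (A' `*` B')) ->
  (forall n, m1 (A n `*` B n) < +oo) ->
  m1 (~` \bigcup_n (A n `*` B n)) = 0 -> m2 (~` \bigcup_n (A n `*` B n)) = 0 ->
  forall S, measurable S -> m1 S = m2 S.
Proof.
move=> mA mB m12 m1oo m10 m20 S mS.
pose F n := A n `*` B n; pose G := \bigcup_n F n.
have mF n : measurable (F n) by exact: measurableX.
have mG : measurable G by exact: bigcupT_measurable.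
have on_F n S' : measurable S' -> m1 (S' `&` F n) = m2 (S' `&` F n).
  move=> mS'.
  pose C : set (set (T1 * T2)) :=
    [set A' `*` B' | A' in measurable & B' in measurable].
  apply: (@measure_unique _ _ _ C (fun=> setT) _ _ _ _
    (mrestr m1 (mF n)) (mrestr m2 (mF n)) _ _ S') => //.
  - by rewrite measurable_prod_measurableType.
  - move=> _ _ [A1 mA1 [B1 mB1 <-]] [A2 mA2 [B2 mB2 <-]].
    rewrite -setXI; exists (A1 `&` A2); first exact: measurableI.
    by exists (B1 `&` B2) => //; exact: measurableI.
  - move=> _; exists setT => //; exists setT => //; exact: setXTT.
  - by rewrite bigcup_const.
  - move=> _ [A' mA' [B' mB' <-]]; rewrite /= /mrestr /F -setXI.
    by apply: m12; exact: measurableI.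
  - by move=> _; rewrite /= /mrestr setTI; exact: m1oo.
have mD n : measurable (seqDU F n) by exact: seqDU_measurable.
have split_G (m : {measure set (T1 * T2) -> \bar R}) : m (~` G) = 0 ->
    m S = \sum_(n <oo) m (S `&` seqDU F n `&` F n).
  move=> mG0.
  have SG0 : m (S `\` G) = 0.
    have mSG : measurable (S `\` G) by exact: measurableD.
    by apply: (subset_measure0 mSG (measurableC mG)) => // x [].
  have -> : m S = m (S `\` G) + m (S `&` G) by exact: measureDI.
  rewrite SG0.
  rewrite add0e /G seqDU_bigcup_eq setI_bigcupr measure_bigcup//; last 2 first.
  - by move=> n _; exact: measurableI.
  - exact/trivIset_setIl/trivIset_seqDU.
  rewrite (@eq_eseriesl _ _ xpredT); last by move=> n; rewrite in_setT.
  apply: eq_eseriesr => n _; congr (m _); rewrite -setIA; congr (_ `&` _).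
  by rewrite setIidl// => x [].
rewrite (split_G m1 m10) (split_G m2 m20); apply: eq_eseriesr => n _.
by apply: on_F; exact: measurableI.
Qed.

(** A measurable singleton of positive measure would be an atom, as its only
    proper subset is empty. *)
Lemma non_atomic_set1 d (T : measurableType d) (R : realType)
    (mu : {measure set T -> \bar R}) (x : T) :
  non_atomic mu -> measurable [set x] -> mu [set x] = 0.
Proof.
move=> na mx; apply/eqP; apply: contrapT => /negP mux0.
apply: (na [set x]); split=> //; first by rewrite lt_neqAle eq_sym mux0/=.
move=> B mB Bx muB; have [B0|/set0P[y By]] := eqVneq B set0.
  by rewrite B0 measure0.
have BE : B = [set x].
  by apply/seteqP; split=> // z ->; have <- : y = x by exact: Bx.
by move: muB; rewrite BE ltxx.
Qed.

Section georgii_nguyen_zessin.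
Variables (R : realType) (X : completePseudoMetricType R).
Hypothesis hX : hausdorff_space X.
Variable U : nat -> set X.
Hypothesis bU : base_seq U.
Hypothesis mcount : forall A : set (borel X), measurable A ->
  measurable_fun setT (fun w : Omega X => config_measure R w A).
Variables (D : nat -> set (Omega X)) (p : nat -> Omega X -> borel X).
Hypothesis Dp : measurable_enumeration D p.
Variable P : probability (Omega X) R.

Let esum_config_del_measurable (h : borel X * Omega X -> \bar R) :
  measurable_fun setT h -> (forall q, 0 <= h q) ->
  measurable_fun setT (fun w : Omega X =>
    \esum_(x in points w) h (x, config_del w x : Omega X)).
Proof.
move=> mh h0.
apply: (measurable_esum_config Dp (phi := id)
  (h := fun w x => h (x, config_del (w : config X) x : Omega X))) => //.
apply: (measurableT_comp mh); apply: measurable_fun_pair => //.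
exact: (measurableT_comp (measurable_config_del hX bU mcount)
  (@measurable_swap _ _ _ _)).
Qed.

(** The pair of a point and the remaining configuration is distributed over the
    labels of the points: the [n]-th label contributes the image of the
    restriction of [P] to [D n], and the measure is the sum of these images. *)
Lemma campbell_measure :
  exists m : {measure set (borel X * Omega X) -> \bar R},
  forall h, measurable_fun setT h -> (forall q, 0 <= h q) ->
    \int[m]_q h q =
    \int[P]_w \esum_(x in points w) h (x, config_del w x : Omega X).
Proof.
have [mD mp _] := Dp.
pose phi n (w : Omega X) : borel X * Omega X :=
  (p n w, config_del w (p n w) : Omega X).
have mphi n : measurable_fun setT (phi n).
  apply: measurable_fun_pair => //.
  exact: (measurableT_comp (measurable_config_del hX bU mcount)
    (measurable_fun_pair (mp n) (@measurable_id _ _ _))).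
have mI n : measurable_fun setT (fun w => (\1_(D n) w)%:E : \bar R).
  by apply/measurable_EFinP; exact: measurable_indic.
have /choice[mn mnE] : forall n, exists m : {measure set (borel X * Omega X) -> \bar R},
    forall h, measurable_fun setT h -> (forall q, 0 <= h q) ->
      \int[m]_q h q = \int[P]_w ((\1_(D n) w)%:E * h (phi n w)).
  move=> n; have [|nu [_ nuE]] := @density_measure _ _ _ P _ (mI n).
    by move=> w; rewrite lee_fin.
  pose k mphi' : {measure set (borel X * Omega X) -> \bar R} :=
    @measure_function_pushforward__canonical__measure_function_Measure
      _ _ _ _ _ nu (phi n) mphi'.
  exists (k (mphi n)) => h mh h0; rewrite ge0_integral_pushforward//.
  rewrite preimage_setT nuE//; last 2 first.
  - exact: (measurableT_comp mh (mphi n)).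
  - by move=> w; exact: h0.
  by apply: eq_integral => w _; rewrite muleC.
exists (mseries mn 0) => h mh h0; rewrite ge0_integral_measure_series//.
under eq_eseriesr do rewrite mnE//.
rewrite -integral_nneseries//; last 2 first.
- by move=> n; apply: emeasurable_funM => //; exact: (measurableT_comp mh (mphi n)).
- by move=> n w _; rewrite mule_ge0// lee_fin.
apply: eq_integral => w _.
by rewrite (esum_enumeration Dp w (h := fun x => h (x, config_del w x : Omega X))).
Qed.

Variables (lambda : {sigma_finite_measure set (borel X) -> \bar R}).
Variable (c : borel X * Omega X -> \bar R).
Hypothesis (na : non_atomic lambda) (hc : papangelou_density P lambda c).

Let measurable_set1 (x : X) : measurable ([set x] : set (borel X)).
Proof.
rewrite -[X in measurable X]setCK; apply: measurableC; apply: measurable_open_borel.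
exact/closed_openC/accessible_closed_set1/hausdorff_accessible.
Qed.

Let measurable_config_points (w : config X) :
  measurable (points w : set (borel X)).
Proof.
apply: countable_measurable; last exact: (config_countable hX bU).
exact: measurable_set1.
Qed.

Let lambda_config (w : config X) : lambda (points w) = 0.
Proof.
have [_ _ /(_ w) [_ _ surj]] := Dp.
have : lambda.-negligible (\bigcup_n [set p n w]).
  apply: negligible_bigcup => n; apply/negligibleP; first exact: measurable_set1.
  exact: non_atomic_set1 na (measurable_set1 _).
move=> neg; apply/(negligibleP _ (measurable_config_points w)); apply: negligibleS neg => x wx.
by have [n _ <-] := surj _ wx; exists n.
Qed.

Let diagonal_null :
  (lambda \x P) [set q : borel X * Omega X | points q.2 q.1] = 0.
Proof.
have mdiag := measurable_diagonal hX bU mcount.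
set dg := [set q : borel X * Omega X | points q.2 q.1].
transitivity (\int[lambda \x P]_q (\1_dg q)%:E).
  by rewrite integral_indic// setIT.
rewrite (fubini_tonelli2 (fun q => (\1_dg q)%:E))//; last first.
  by apply/measurable_EFinP; exact: measurable_indic.
apply: integral0_eq => w _; rewrite /fubini_G -[RHS](lambda_config w).
rewrite (eq_integral (fun x => (\1_(points w : set (borel X)) x)%:E)).
  by rewrite integral_indic ?setIT//; exact: measurable_config_points.
by move=> x _; rewrite !indicE; congr (_%:R%:E); apply/idP/idP => /set_mem wx;
  exact/mem_set.
Qed.

Let rect (n : nat) : set (borel X * Omega X) :=
  (U n : set (borel X)) `*` [set w : Omega X | points w `&` U n = set0].

(** The sum has at most one nonzero term: [w] without [x] misses [U n] only when
    [x] is the single point of [w] in [U n]. *)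
Lemma campbell_rectangle_le1 (n : nat) (w : config X) :
  \esum_(x in points w) (\1_(rect n) (x, config_del w x : Omega X))%:E <= 1 :> \bar R.
Proof.
have inR x : points w x -> (x, config_del w x : Omega X) \in rect n ->
    points w `&` U n = [set x].
  move=> wx /set_mem[/= Ux wU]; apply/seteqP; split=> [y [wy Uy]|y ->//].
  apply: contrapT => yx; suff : (set0 : set X) y by [].
  by rewrite -wU; split=> //; split.
have [[x [wx xR]]|nx] := pselect (exists x, points w x /\
    (x, config_del w x : Omega X) \in rect n).
  rewrite (esumID [set x])//= setIidr; last by move=> y ->.
  rewrite esum_set1 ?lee_fin// indicE xR esum1 ?adde0// => y [wy yx].
  rewrite indicE; case: (boolP (_ \in _)) => // yR; case: yx.
  by have : [set x] y by rewrite -(inR _ wx xR) (inR _ wy yR).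
rewrite esum1 ?lee_fin// => y wy; rewrite indicE.
by case: (boolP (_ \in _)) => // yR; case: nx; exists y.
Qed.

(** The Campbell measure [m1] and the measure [m2] with density [c] are compared
    on the rectangles [U n * {w | w does not meet U n}], which have Campbell
    measure at most 1 and cover the pairs [(x, w)] with [x] outside [w]. *)
Lemma georgii_nguyen_zessin (h : borel X * Omega X -> \bar R) :
  measurable_fun setT h -> (forall q, 0 <= h q) ->
  \int[P]_w (\esum_(x in points w) h (x, config_del w x : Omega X)) =
  \int[P]_w \int[lambda]_x (h (x, w) * c (x, w)).
Proof.
move=> mh h0; have [mc c0 cE] := hc.
have [m1 m1E] := campbell_measure.
have [m2 [m2S m2E]] := @density_measure _ _ _ (lambda \x P) _ mc c0.
have mdiag := measurable_diagonal hX bU mcount.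
have m1_set S : measurable S -> m1 S =
    \int[P]_w \esum_(x in points w) (\1_S (x, config_del w x : Omega X))%:E.
  move=> mS; rewrite -(m1E (fun q => (\1_S q)%:E)); last 2 first.
  - by apply/measurable_EFinP; exact: measurable_indic.
  - by move=> q; rewrite lee_fin.
  by rewrite integral_indic// setIT.
have m12 S : measurable S -> m1 S = m2 S.
  apply: (@measure_eq_rectangles _ _ _ _ _ _ _ (fun n => U n : set (borel X))
    (fun n => [set w : Omega X | points w `&` U n = set0])).
  - exact: measurable_base bU.
  - by move=> n; apply: (measurable_config_void mcount); exact: measurable_base bU n.
  - move=> A B mA mB; rewrite m2S; last exact: measurableX.
    rewrite -cE// m1_set; last exact: measurableX.
    apply: eq_integral => w _; rewrite /campbell_integrand integral_mkcond.
    rewrite integral_config_measure; last 3 first.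
    + exact: (config_countable hX bU).
    + apply: (iffLR (measurable_restrictT _ mA)); apply: measurable_funTS.
      apply/measurable_EFinP; apply: (measurableT_comp (measurable_indic mB)).
      exact: (measurableT_comp (measurable_config_del hX bU mcount)
        (measurable_fun_pair (@measurable_id _ _ _) (@measurable_cst _ _ _ _ _ w))).
    + by move=> x; rewrite patchE; case: ifP => // _; rewrite lee_fin.
    apply: eq_esum => x wx; rewrite patchE !indicE in_setX /=.
    by case: (x \in A).
  - move=> n; rewrite m1_set; last first.
      apply: measurableX; first exact: measurable_base bU n.
      by apply: (measurable_config_void mcount); exact: measurable_base bU n.
    apply: (@le_lt_trans _ _ (\int[P]_w 1)); last first.
      by rewrite integral_cst//= mul1e (le_lt_trans (probability_le1 P measurableT))// ltry.
    apply: ge0_le_integral => //.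
    + by move=> w _; apply: esum_ge0 => x _; rewrite lee_fin.
    + apply: (esum_config_del_measurable (h := fun q => (\1_(rect n) q)%:E)).
        apply/measurable_EFinP; apply: measurable_indic.
        apply: measurableX; first exact: measurable_base bU n.
        by apply: (measurable_config_void mcount); exact: measurable_base bU n.
      by move=> q; rewrite lee_fin.
    + by move=> w _; exact: campbell_rectangle_le1.
  - rewrite -(config_off_diagonalE hX bU) m1_set; last first.
      by rewrite (_ : ~` _ = [set q : borel X * Omega X | points q.2 q.1])//;
        apply/seteqP; split=> q /=; [move=> /contrapT|move=> wq].
    apply: integral0_eq => w _; apply: esum1 => x wx.
    by rewrite indicE memNset//= => -[]; case.
  - rewrite -(config_off_diagonalE hX bU).
    rewrite (_ : ~` _ = [set q : borel X * Omega X | points q.2 q.1]); last first.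
      by apply/seteqP; split=> q /=; [move=> /contrapT|move=> wq].
    rewrite m2S//; apply: null_set_integral => //; exact: measurable_funTS.
rewrite -(m1E h)// (eq_measure_integral m2); last by move=> S mS _; exact: m12.
rewrite m2E// (fubini_tonelli2 (fun q => h q * c q))//.
  exact: emeasurable_funM.
by move=> q; rewrite mule_ge0.
Qed.

End georgii_nguyen_zessin.

(** * Iteration over tuples of distinct points *)

(** The sum of [g (z, w \ z)] over the tuples [z] of distinct points of [w],
    written as iterated sums over single points so that the one-point formula
    and the measurability of one-point sums apply at each step. *)
Fixpoint reduced_sum (R : realType) (X : completePseudoMetricType R) (m : nat) :
    (m.-tuple (borel X) * Omega X -> \bar R) -> Omega X -> \bar R :=
  match m with
  | 0 => fun g w => g ([tuple], w)
  | m'.+1 => fun g => reduced_sum (fun q : m'.-tuple (borel X) * Omega X =>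
      \esum_(x in points q.2)
        g ([tuple of (x : borel X) :: q.1], config_del q.2 x : Omega X))
  end.

Section reduced_sums.
Variables (R : realType) (X : completePseudoMetricType R).

Lemma reduced_sum_ge0 (m : nat) (g : m.-tuple (borel X) * Omega X -> \bar R) w :
  (forall q, 0 <= g q) -> 0 <= reduced_sum g w.
Proof.
elim: m g => [|m IHm] g g0 //=; apply: IHm => q.
by apply: esum_ge0 => x _; exact: g0.
Qed.

Definition config_dels (w : config X) (s : seq X) : config X :=
  foldr (fun x v => config_del v x) w s.

Lemma points_config_dels (w : config X) (s : seq X) :
  points (config_dels w s) = points w `\` [set` s].
Proof.
elim: s => [|x s IHs] /=; first by rewrite set_nil setD0.
rewrite IHs; apply/seteqP; split=> y /=.
  move=> [[wy ys] yx]; split=> //; rewrite inE => /orP[/eqP//|].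
  exact: ys.
move=> [wy]; rewrite inE => /negP; rewrite negb_or => /andP[/eqP yx /negP ys].
by split.
Qed.

Lemma config_delsK (w : config X) (s : seq X) :
  (forall x, x \in s -> points w x) -> config_add (config_dels w s) s = w.
Proof.
move=> sw; apply: config_eq => /=; rewrite points_config_dels.
apply/seteqP; split=> [y [[]//|/sw//]|y wy].
by have [ys|ys] := boolP (y \in s); [right|left; split=> //; exact/negP].
Qed.

Lemma reduced_sumE (m : nat) (g : m.-tuple (borel X) * Omega X -> \bar R)
    (w : Omega X) : (forall q, 0 <= g q) ->
  reduced_sum g w =
  \esum_(z in tuples_in (points w : set (borel X)) m `&` [set z | uniq z])
    g (z, config_dels w z : Omega X).
Proof.
elim: m g => [|m IHm] g g0 /=; first by rewrite esum_tuple0.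
rewrite IHm; last by move=> q; exact: esum_ge0.
rewrite (esum_uniq_tuple_tail (points w : set (borel X))
  (f := fun z => g (z, config_dels w z : Omega X)))//.
by apply: eq_esum => s _; rewrite /= points_config_dels.
Qed.

Lemma reduced_sum_addE (m : nat) (f : m.-tuple (borel X) * Omega X -> \bar R)
    (w : Omega X) : (forall q, 0 <= f q) ->
  reduced_sum (fun q => f (q.1, config_add q.2 q.1 : Omega X)) w =
  \esum_(z in tuples_in (points w : set (borel X)) m `&` [set z | uniq z]) f (z, w).
Proof.
move=> f0; rewrite reduced_sumE//; apply: eq_esum => z [/= wz _].
by rewrite config_delsK.
Qed.

End reduced_sums.

Section iterated_gnz.
Variables (R : realType) (X : completePseudoMetricType R).
Hypothesis hX : hausdorff_space X.
Variable U : nat -> set X.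
Hypothesis bU : base_seq U.
Hypothesis mcount : forall A : set (borel X), measurable A ->
  measurable_fun setT (fun w : Omega X => config_measure R w A).
Variables (D : nat -> set (Omega X)) (p : nat -> Omega X -> borel X).
Hypothesis Dp : measurable_enumeration D p.

Let measurable_tail (m : nat) : measurable_fun setT
  (fun q : m.+1.-tuple (borel X) * Omega X => [tuple of behead q.1]).
Proof. exact: (measurableT_comp (@measurable_behead _ _ m) measurable_fst). Qed.

Let measurable_add_head (m : nat) : measurable_fun setT
  (fun q : m.+1.-tuple (borel X) * Omega X =>
    config_add q.2 [:: thead q.1] : Omega X).
Proof.
exact: (measurableT_comp (measurable_config_add1 hX bU mcount)
  (measurable_fun_pair (measurableT_comp (@measurable_tnth _ _ _ ord0)
    (@measurable_fst _ _ _ _)) (@measurable_snd _ _ _ _))).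
Qed.

Lemma measurable_config_add (m : nat) : measurable_fun setT
  (fun q : m.-tuple (borel X) * Omega X => config_add q.2 q.1 : Omega X).
Proof.
elim: m => [|m IHm].
  apply: (eq_measurable_fun snd) => //= -[z w] _ /=; rewrite (tuple0 z) /=.
  by apply: config_eq => /=; rewrite set_nil setU0.
apply: (eq_measurable_fun (fun q : m.+1.-tuple (borel X) * Omega X =>
    config_add (config_add q.2 [:: thead q.1]) [tuple of behead q.1] : Omega X)).
  move=> [z w] _ /=; case/tupleP: z => x s /=.
  by rewrite theadE [RHS]config_add_cons.
exact: (measurableT_comp IHm
  (measurable_fun_pair (@measurable_tail m) (@measurable_add_head m))).
Qed.

Let measurable_head_sum (m : nat)
    (g : m.+1.-tuple (borel X) * Omega X -> \bar R) :
  measurable_fun setT g -> (forall q, 0 <= g q) ->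
  measurable_fun setT (fun q : m.-tuple (borel X) * Omega X =>
    \esum_(x in points q.2)
      g ([tuple of (x : borel X) :: q.1], config_del q.2 x : Omega X)).
Proof.
move=> mg g0; apply: (measurable_esum_config Dp (phi := snd)
  (h := fun (q : m.-tuple (borel X) * Omega X) x =>
    g ([tuple of (x : borel X) :: q.1], config_del q.2 x : Omega X))) => //.
apply: (measurableT_comp mg); apply: measurable_fun_pair.
  apply: measurable_cons => //.
  exact: (measurableT_comp measurable_fst measurable_fst).
exact: (measurableT_comp (measurable_config_del hX bU mcount)
  (measurable_fun_pair (@measurable_snd _ _ _ _)
    (measurableT_comp (@measurable_snd _ _ _ _) (@measurable_fst _ _ _ _)))).
Qed.

Lemma measurable_reduced_sum (m : nat)
    (g : m.-tuple (borel X) * Omega X -> \bar R) :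
  measurable_fun setT g -> (forall q, 0 <= g q) ->
  measurable_fun setT (reduced_sum g).
Proof.
elim: m g => [|m IHm] g mg g0 /=.
  exact: (measurableT_comp mg (measurable_fun_pair (@measurable_cst _ _ _ _ _ [tuple])
    (@measurable_id _ _ _))).
apply: IHm => [|q]; last exact: esum_ge0.
exact: measurable_head_sum.
Qed.

Lemma esum_integral_exchange d (T : measurableType d)
    (nu : {measure set T -> \bar R}) (w : Omega X) (F : X -> T -> \bar R) :
  (forall x, measurable_fun setT (F x)) -> (forall x t, 0 <= F x t) ->
  \int[nu]_t (\esum_(x in points w) F x t) =
  \esum_(x in points w) \int[nu]_t F x t.
Proof.
move=> mF F0.
rewrite (esum_enumeration Dp w (h := fun x => \int[nu]_t F x t)); last first.
  by move=> x; exact: integral_ge0.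
under eq_integral do rewrite (esum_enumeration Dp)//.
rewrite integral_nneseries//; last 2 first.
- by move=> n; exact: measurable_funeM.
- by move=> n t _; rewrite mule_ge0// lee_fin.
by apply: eq_eseriesr => n _; rewrite ge0_integralZl// lee_fin.
Qed.

Variables (P : probability (Omega X) R).
Variables (lambda : {sigma_finite_measure set (borel X) -> \bar R}).
Variable (c : borel X * Omega X -> \bar R).
Hypothesis (na : non_atomic lambda) (hc : papangelou_density P lambda c).

Lemma compound_campbell_ge0 (s : seq X) (w : Omega X) :
  0 <= compound_campbell c s w.
Proof.
have [_ c0 _] := hc.
by elim: s w => [|x s IHs] w //=; rewrite mule_ge0.
Qed.

Lemma measurable_compound_campbell (m : nat) : measurable_fun setT
  (fun q : m.-tuple (borel X) * Omega X => compound_campbell c q.1 q.2).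
Proof.
have [mc _ _] := hc.
elim: m => [|m IHm].
  by apply: (eq_measurable_fun (cst 1)) => //= -[z w] _ /=; rewrite (tuple0 z).
apply: (eq_measurable_fun (fun q : m.+1.-tuple (borel X) * Omega X =>
    c (thead q.1, q.2) *
    compound_campbell c [tuple of behead q.1] (config_add q.2 [:: thead q.1]))).
  by move=> [z w] _ /=; case/tupleP: z => x s /=; rewrite theadE.
apply: emeasurable_funM.
  apply: (measurableT_comp mc); apply: measurable_fun_pair => //.
  exact: (measurableT_comp (@measurable_tnth _ _ _ ord0) measurable_fst).
exact: (measurableT_comp IHm
  (measurable_fun_pair (@measurable_tail m) (@measurable_add_head m))).
Qed.

(** The head of a tuple is the point whose factor [c] sees the smallest
    configuration.  The one-point formula is used from right to left for this
    point: it turns the factor [c (x, w)] into a sum over the points [x] of the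
    configuration and restores [w] inside the remaining compound density, which
    no longer depends on [x]. *)
Theorem iterated_gnz (m : nat) (g : m.-tuple (borel X) * Omega X -> \bar R) :
  measurable_fun setT g -> (forall q, 0 <= g q) ->
  \int[P]_w \int[power_measure lambda m]_z
    (g (z, w) * compound_campbell c z w) =
  \int[P]_w reduced_sum g w.
Proof.
have [mc c0 _] := hc.
elim: m g => [|m IHm] g mg g0.
  apply: eq_integral => w _; rewrite integral_power_measure0 /= ?mule1//.
  apply: (eq_measurable_fun (fun z => g (z, w))) => [z _|].
    by rewrite (tuple0 z) /= mule1.
  exact: (measurableT_comp mg (measurable_fun_pair (@measurable_id _ _ _)
    (@measurable_cst _ _ _ _ _ w))).
pose inner (q : borel X * Omega X) (s : m.-tuple (borel X)) :=
  g ([tuple of q.1 :: s], q.2) *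
  compound_campbell c s (config_add q.2 [:: q.1]).
pose H (q : borel X * Omega X) := \int[power_measure lambda m]_s inner q s.
have inner0 q s : 0 <= inner q s by rewrite mule_ge0// compound_campbell_ge0.
have minner : measurable_fun setT
    (fun q : (borel X * Omega X) * m.-tuple (borel X) => inner q.1 q.2).
  apply: emeasurable_funM.
    apply: (measurableT_comp mg); apply: measurable_fun_pair.
      by apply: measurable_cons => //; exact: (measurableT_comp measurable_fst measurable_fst).
    exact: (measurableT_comp measurable_snd measurable_fst).
  exact: (measurableT_comp (@measurable_compound_campbell m) (measurable_fun_pair
    (@measurable_snd _ _ _ _) (measurableT_comp (measurable_config_add1 hX bU mcount)
      (@measurable_fst _ _ _ _)))).
have minner_q q : measurable_fun setT (inner q).
  exact: (measurableT_comp minner (measurable_fun_pair (@measurable_cst _ _ _ _ _ q)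
    (@measurable_id _ _ _))).
have mH : measurable_fun setT H by exact: measurable_integral_power_measure.
have [nu nuE] := power_measure_sigma_finite lambda m.
have H0 q : 0 <= H q by rewrite /H nuE; apply: integral_ge0 => s _; exact: inner0.
transitivity (\int[P]_w \int[lambda]_x (H (x, w) * c (x, w))).
  apply: eq_integral => w _; rewrite integral_power_measureS; last 2 first.
  - apply: emeasurable_funM.
      exact: (measurableT_comp mg (measurable_fun_pair (@measurable_id _ _ _)
        (@measurable_cst _ _ _ _ _ w))).
    exact: (measurableT_comp (@measurable_compound_campbell m.+1) (measurable_fun_pair
      (@measurable_id _ _ _) (@measurable_cst _ _ _ _ _ w))).
  - by move=> z; rewrite mule_ge0// compound_campbell_ge0.
  apply: eq_integral => x _; rewrite muleC /H /inner /=.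
  rewrite nuE -ge0_integralZl//; last 2 first.
  - exact: (minner_q (x, w)).
  - by move=> s _; exact: (inner0 (x, w)).
  by apply: eq_integral => s _; rewrite muleCA.
rewrite -(georgii_nguyen_zessin hX bU mcount Dp na hc mH H0).
rewrite /= -IHm; last 2 first.
- exact: measurable_head_sum.
- by move=> q; exact: esum_ge0.
apply: eq_integral => w _.
rewrite /H nuE.
transitivity (\esum_(x in points w) \int[nu]_s
    (g ([tuple of (x : borel X) :: s], config_del w x : Omega X) *
     compound_campbell c s w)).
  apply: eq_esum => x wx; apply: eq_integral => s _; rewrite /inner /=.
  by rewrite config_delK.
rewrite -esum_integral_exchange//; last 2 first.
- move=> x; apply: emeasurable_funM.
    apply: (measurableT_comp mg); apply: measurable_fun_pair => //.
    exact: measurable_cons.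
  exact: (measurableT_comp (@measurable_compound_campbell m) (measurable_fun_pair
    (@measurable_id _ _ _) (@measurable_cst _ _ _ _ _ w))).
- by move=> x s; rewrite mule_ge0// compound_campbell_ge0.
apply: eq_integral => s _ /=; rewrite [RHS]muleC.
rewrite -ge0_esumZl//; last exact: compound_campbell_ge0.
by apply: eq_esum => x _; rewrite muleC.
Qed.

End iterated_gnz.

(** * Expansion over sign patterns *)

Section sign_patterns.
Variable R : realType.

Definition signed_part (b : bool) (x : R) : R := Num.max ((-1) ^+ b * x)%R 0%R.

Lemma signed_part_ge0 b x : (0 <= signed_part b x)%R.
Proof. by rewrite le_max lexx orbT. Qed.

Lemma signed_part_le b x : (signed_part b x <= `|x|)%R.
Proof.
rewrite ge_max normr_ge0 andbT; apply: le_trans (ler_norm _) _.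
by rewrite normrM normrX normrN1 expr1n mul1r.
Qed.

Lemma measurable_signed_part d (T : measurableType d) b (u : T -> R) :
  measurable_fun setT u -> measurable_fun setT (signed_part b \o u).
Proof. by move=> mu; apply: measurable_maxr => //; exact: measurable_funM. Qed.

Definition pattern_sign (n : nat) (e : {ffun 'I_n -> bool}) : R :=
  \prod_(k < n) (-1) ^+ e k.

(** At most one sign pattern contributes to the sum at a given point, which is
    why the expansion survives the multiplication by an infinite [C]. *)
Lemma signed_expansion (n : nat) (x : 'I_n -> R) (C : \bar R) :
  (\prod_(k < n) x k)%:E * C =
  \sum_(e : {ffun 'I_n -> bool}) (pattern_sign e)%:E *
    ((\prod_(k < n) signed_part (e k) (x k))%:E * C).
Proof.
(* The pattern of the actual signs of the [x k]. *)
pose e0 : {ffun 'I_n -> bool} := [ffun k => (x k < 0)%R].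
rewrite (bigD1 e0)//= [X in _ + X]big1 ?adde0.
  rewrite muleA -EFinM -big_split /=; congr ((_)%:E * _).
  apply: eq_bigr => k _; rewrite ffunE /signed_part.
  have [xk|xk] := ltP (x k) 0%R.
    by rewrite expr1 max_l ?mulrA ?mulrNN ?mul1r// mulN1r oppr_ge0 ltW.
  by rewrite expr0 !mul1r max_l.
move=> e ee0; have [k ek] : exists k, e k != e0 k.
  by apply/existsP; apply: contraNT ee0 => /existsPn ek; apply/eqP/ffunP => k;
    apply/eqP; rewrite -[_ == _]negbK ek.
suff -> : (\prod_(k < n) signed_part (e k) (x k) = 0)%R by rewrite mul0e mule0.
rewrite (bigD1 k)//= (_ : signed_part _ _ = 0)%R ?mul0r//.
move: ek; rewrite ffunE /signed_part.
have [xk|xk] := ltP (x k) 0%R; case: (e k) => //= _.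
  by rewrite expr0 mul1r max_r// ltW.
by rewrite expr1 mulN1r max_r// oppr_le0.
Qed.

Lemma sum_power_signed (n : nat) (a : bool -> R) :
  ((a false - a true) ^+ n =
   \sum_(e : {ffun 'I_n -> bool}) pattern_sign e * \prod_(k < n) a (e k))%R.
Proof.
have -> : (a false - a true = \sum_(b : bool) (-1) ^+ b * a b)%R.
  by rewrite big_bool /= expr1 expr0 mulN1r mul1r addrC.
rewrite -[n in LHS]card_ord -prodr_const bigA_distr_bigA /=.
by apply: eq_bigr => e _; rewrite -big_split.
Qed.

Lemma expe_prode (n : nat) (x : \bar R) : x ^+ n = \prod_(k < n) x.
Proof.
by elim: n => [|n IHn]; rewrite ?big_ord0 ?expe0// big_ord_recl expeS IHn.
Qed.

Lemma expe_infty (n : nat) : (0 < n)%N -> +oo ^+ n = +oo :> \bar R.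
Proof.
case: n => // n _; elim: n => [|n IHn]; first by rewrite expeS expe0 mule1.
by rewrite expeS IHn mulyy.
Qed.

Lemma measurable_expe d (T : measurableType d) (n : nat) (f : T -> \bar R) :
  measurable_fun setT f -> measurable_fun setT (fun x => f x ^+ n).
Proof.
move=> mf; elim: n => [|n IHn].
  apply: (eq_measurable_fun (cst 1)) => [x _|]; [by rewrite expe0|exact: measurable_cst].
apply: (eq_measurable_fun (fun x => f x * f x ^+ n)) => [x _|].
  by rewrite expeS.
exact: emeasurable_funM.
Qed.

End sign_patterns.
Arguments pattern_sign {R n} e.

(** * Moments of multiple sums over a configuration *)

Section moments.
Variables (R : realType) (X : completePseudoMetricType R).
Hypothesis hX : hausdorff_space X.
Variable U : nat -> set X.
Hypothesis bU : base_seq U.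
Hypothesis mcount : forall A : set (borel X), measurable A ->
  measurable_fun setT (fun w : Omega X => config_measure R w A).
Variables (D : nat -> set (Omega X)) (p : nat -> Omega X -> borel X).
Hypothesis Dp : measurable_enumeration D p.

Definition config_integral (r : nat) (v : r.-tuple (borel X) * Omega X -> R)
    (w : Omega X) : \bar R :=
  \int[power_measure (config_measure R w) r]_z (v (z, w))%:E.

Definition selected_product (n r : nat) (rho : partitions n r)
    (v : 'I_n -> r.-tuple (borel X) * Omega X -> R)
    (q : #|val rho|.-tuple (borel X) * Omega X) : \bar R :=
  (\prod_(k < n) v k (select q.1 k, q.2))%:E.

Section selected_product_measurability.
Variables (n r : nat) (rho : partitions n r).
Variable v : 'I_n -> r.-tuple (borel X) * Omega X -> R.
Hypothesis mv : forall k, measurable_fun setT (v k).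

Lemma measurable_selected_product : measurable_fun setT (selected_product (rho := rho) v).
Proof.
apply/measurable_EFinP; apply: measurable_prod => k _.
apply: (measurableT_comp (mv k)); apply: measurable_fun_pair => //.
apply/measurable_fun_tnthP => l.
apply: (eq_measurable_fun (fun q : #|val rho|.-tuple (borel X) * Omega X =>
    tnth q.1 (zeta rho (k, l)))).
  by move=> q _ /=; rewrite tnth_mktuple.
exact: (measurableT_comp (@measurable_tnth _ _ _ (zeta rho (k, l))) measurable_fst).
Qed.

Lemma measurable_selected_product_add : measurable_fun setT
  (fun q : #|val rho|.-tuple (borel X) * Omega X =>
    selected_product v (q.1, config_add q.2 q.1 : Omega X)).
Proof.
apply: (measurableT_comp measurable_selected_product).
apply: measurable_fun_pair => //; exact: (measurable_config_add hX bU mcount).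
Qed.

End selected_product_measurability.

(** The integrands depend on [k] so that positive and negative parts can be
    mixed when [u] is signed. *)
Lemma prod_config_integral (n r : nat)
    (v : 'I_n -> r.-tuple (borel X) * Omega X -> R) (w : Omega X) :
  (forall k, measurable_fun setT (v k)) -> (forall k q, (0 <= v k q)%R) ->
  \prod_(k < n) config_integral (v k) w =
  \sum_(rho : partitions n r) reduced_sum
    (fun q : #|val rho|.-tuple (borel X) * Omega X =>
    selected_product v (q.1, config_add q.2 q.1 : Omega X)) w.
Proof.
move=> mv v0; pose W : set (borel X) := points w.
under eq_bigr => k _.
  rewrite /config_integral (integral_power_config_measure hX bU); last 2 first.
  - apply/measurable_EFinP; apply: (measurableT_comp (mv k)).
    exact: measurable_fun_pair.
  - by move=> z; rewrite lee_fin.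
  over.
rewrite (prode_esum (tuples_in W r) (F := fun k z => (v k (z, w))%:E)); last first.
  by move=> k z; rewrite lee_fin.
rewrite (esum_partitions W (g := fun t : n.-tuple (r.-tuple (borel X)) =>
  \prod_(k < n) (v k (tnth t k, w))%:E)); last first.
  by move=> t; apply: prode_ge0 => k _; rewrite lee_fin.
apply: eq_bigr => rho _; rewrite (reduced_sum_addE (f := selected_product v)).
  apply: eq_esum => z _; rewrite /selected_product -prodEFin /=.
  by apply: eq_bigr => k _; rewrite tnth_mktuple.
by move=> q; rewrite lee_fin prodr_ge0.
Qed.

Lemma measurable_prod_config_integral (n r : nat)
    (v : 'I_n -> r.-tuple (borel X) * Omega X -> R) :
  (forall k, measurable_fun setT (v k)) -> (forall k q, (0 <= v k q)%R) ->
  measurable_fun setT (fun w => \prod_(k < n) config_integral (v k) w).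
Proof.
move=> mv v0; under [X in measurable_fun _ X]eq_fun do rewrite prod_config_integral//.
apply: emeasurable_sum => rho.
apply: (measurable_reduced_sum hX bU mcount Dp).
  exact: measurable_selected_product_add.
by move=> q; rewrite lee_fin prodr_ge0.
Qed.

Variables (P : probability (Omega X) R).
Variables (lambda : {sigma_finite_measure set (borel X) -> \bar R}).
Variable (c : borel X * Omega X -> \bar R).
Hypothesis (na : non_atomic lambda) (hc : papangelou_density P lambda c).

Definition term_integrand (n r : nat) (rho : partitions n r)
    (v : 'I_n -> r.-tuple (borel X) * Omega X -> R)
    (q : #|val rho|.-tuple (borel X) * Omega X) : \bar R :=
  selected_product v (q.1, config_add q.2 q.1 : Omega X)
  * compound_campbell c q.1 q.2.

Definition partition_term (n r : nat) (rho : partitions n r)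
    (v : 'I_n -> r.-tuple (borel X) * Omega X -> R) : \bar R :=
  \int[P]_w \int[power_measure lambda #|val rho|]_z
    term_integrand (rho := rho) v (z, w).

Lemma integral_prod_config_integral (n r : nat)
    (v : 'I_n -> r.-tuple (borel X) * Omega X -> R) :
  (forall k, measurable_fun setT (v k)) -> (forall k q, (0 <= v k q)%R) ->
  \int[P]_w \prod_(k < n) config_integral (v k) w =
  \sum_(rho : partitions n r) partition_term rho v.
Proof.
move=> mv v0.
have sp0 rho q : 0 <= selected_product (rho := rho) v q.
  by rewrite lee_fin prodr_ge0.
under eq_integral do rewrite prod_config_integral//.
rewrite ge0_integral_sum//; last 2 first.
- move=> rho; apply: (measurable_reduced_sum hX bU mcount Dp) => //.
  exact: measurable_selected_product_add.
- by move=> rho w _; exact: reduced_sum_ge0.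
apply: eq_bigr => rho _.
rewrite -(iterated_gnz hX bU mcount Dp na hc)//.
exact: measurable_selected_product_add.
Qed.

Lemma config_integral_ge0 (r : nat) (v : r.-tuple (borel X) * Omega X -> R) w :
  (forall q, (0 <= v q)%R) -> 0 <= config_integral v w.
Proof.
move=> v0; rewrite /config_integral.
have [mu ->] := config_measure_sigma_finite (R := R) hX bU w.
have [nu ->] := power_measure_sigma_finite mu r.
by apply: integral_ge0 => z _; rewrite lee_fin.
Qed.

Lemma config_integral_signed (r : nat) (u : r.-tuple (borel X) * Omega X -> R) w :
  config_integral u w = config_integral (signed_part false \o u) w -
                        config_integral (signed_part true \o u) w.
Proof.
rewrite /config_integral.
have [mu ->] := config_measure_sigma_finite (R := R) hX bU w.
have [nu ->] := power_measure_sigma_finite mu r.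
rewrite integralE; congr (_ - _); apply: eq_integral => z _.
  by rewrite funeposE /= /signed_part expr0 mul1r EFin_max.
by rewrite funenegE /= /signed_part expr1 mulN1r EFin_max.
Qed.

Lemma partition_term_ge0 (n r : nat) (rho : partitions n r)
    (v : 'I_n -> r.-tuple (borel X) * Omega X -> R) :
  (forall k q, (0 <= v k q)%R) -> 0 <= partition_term rho v.
Proof.
move=> v0; rewrite /partition_term.
have [nu ->] := power_measure_sigma_finite lambda #|val rho|.
apply: integral_ge0 => w _; apply: integral_ge0 => z _.
by rewrite mule_ge0 ?(compound_campbell_ge0 hc)// lee_fin prodr_ge0.
Qed.

Section term_integrand.
Variables (n r : nat) (rho : partitions n r).

Lemma measurable_term_integrand (v : 'I_n -> r.-tuple (borel X) * Omega X -> R) :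
  (forall k, measurable_fun setT (v k)) ->
  measurable_fun setT (term_integrand (rho := rho) v).
Proof.
move=> mv; apply: emeasurable_funM; first exact: measurable_selected_product_add.
exact: (measurable_compound_campbell hX bU mcount hc).
Qed.

Lemma term_integrand_ge0 (v : 'I_n -> r.-tuple (borel X) * Omega X -> R) q :
  (forall k q, (0 <= v k q)%R) -> 0 <= term_integrand (rho := rho) v q.
Proof.
by move=> v0; rewrite mule_ge0 ?(compound_campbell_ge0 hc)// lee_fin prodr_ge0.
Qed.

Lemma le_partition_term (v v' : 'I_n -> r.-tuple (borel X) * Omega X -> R) :
  (forall k, measurable_fun setT (v k)) -> (forall k, measurable_fun setT (v' k)) ->
  (forall k q, (0 <= v k q)%R) -> (forall k q, (v k q <= v' k q)%R) ->
  partition_term rho v <= partition_term rho v'.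
Proof.
move=> mv mv' v0 vv'; have v'0 k q : (0 <= v' k q)%R by exact: le_trans (vv' k q).
rewrite /partition_term; have [nu ->] := power_measure_sigma_finite lambda #|val rho|.
have mt (f : 'I_n -> r.-tuple (borel X) * Omega X -> R) w :
    (forall k, measurable_fun setT (f k)) ->
    measurable_fun setT (fun z => term_integrand (rho := rho) f (z, w)).
  by move=> mf; exact: (measurableT_comp (measurable_term_integrand mf)
    (measurable_fun_pair (@measurable_id _ _ _) (@measurable_cst _ _ _ _ _ w))).
have mG (f : 'I_n -> r.-tuple (borel X) * Omega X -> R) :
    (forall k, measurable_fun setT (f k)) -> (forall k q, (0 <= f k q)%R) ->
    measurable_fun setT (fun w => \int[nu]_z term_integrand (rho := rho) f (z, w)).
  move=> mf f0.
  apply: (@measurable_fun_fubini_tonelli_G _ _ _ _ _ nu _ (measurable_term_integrand mf)).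
  by move=> q; exact: term_integrand_ge0.
apply: ge0_le_integral; first exact: measurableT.
- by move=> w _; apply: integral_ge0 => z _; exact: (@term_integrand_ge0 v (z, w)).
- exact: mG.
- exact: mG.
move=> w _; apply: ge0_le_integral; first exact: measurableT.
- by move=> z _; exact: (@term_integrand_ge0 v (z, w)).
- exact: mt.
- exact: mt.
move=> z _; apply: lee_wpmul2r; first exact: (compound_campbell_ge0 hc).
by rewrite lee_fin ler_prod// => k _; rewrite v0 vv'.
Qed.

(** Fubini on the product of the power of [lambda] with [P]: each pattern is
    integrable there because its parts are dominated by [`|u|]. *)
Lemma partition_term_signed (u : r.-tuple (borel X) * Omega X -> R) :
  measurable_fun setT u ->
  partition_term rho (fun _ : 'I_n => fun q => `|u q|%R) < +oo ->
  partition_term rho (fun _ : 'I_n => u) =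
  \sum_(e : {ffun 'I_n -> bool}) (pattern_sign e)%:E *
    partition_term rho (fun k => signed_part (e k) \o u).
Proof.
move=> mu uoo; pose v (e : {ffun 'I_n -> bool}) k := signed_part (e k) \o u.
have mv e k : measurable_fun setT (v e k) by exact: measurable_signed_part.
have v0 e k q : (0 <= v e k q)%R by exact: signed_part_ge0.
have voo e : partition_term rho (v e) < +oo.
  apply: le_lt_trans uoo; apply: le_partition_term => //.
  - by move=> k; exact: measurableT_comp.
  - by move=> k q; exact: signed_part_le.
move: voo; rewrite /partition_term.
have [nu ->] := power_measure_sigma_finite lambda #|val rho| => voo.
have iv e : (nu \x P).-integrable setT (term_integrand (rho := rho) (v e)).
  apply/integrable21ltyP; first exact: measurable_term_integrand.
  apply: le_lt_trans (voo e); rewrite le_eqVlt; apply/orP; left; apply/eqP.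
  apply: eq_integral => w _; apply: eq_integral => z _.
  by rewrite gee0_abs// term_integrand_ge0.
have isv e : (nu \x P).-integrable setT
    (fun q => (pattern_sign e)%:E * term_integrand (v e) q).
  exact: integrableZl.
have uE : term_integrand (rho := rho) (fun=> u) = fun q =>
    \sum_(e : {ffun 'I_n -> bool}) (pattern_sign e)%:E * term_integrand (v e) q.
  by apply/funext => q; rewrite /term_integrand /selected_product signed_expansion.
transitivity (\int[nu \x P]_q term_integrand (fun=> u) q).
  rewrite -integral21_prod_meas1// uE; exact: integrable_sum.
rewrite uE integral_sum//; apply: eq_bigr => e _.
by rewrite integralZl// -integral21_prod_meas1.
Qed.

End term_integrand.

Lemma measurable_config_integral (r : nat) (v : r.-tuple (borel X) * Omega X -> R) :
  measurable_fun setT v -> (forall q, (0 <= v q)%R) ->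
  measurable_fun setT (config_integral v).
Proof.
move=> mv v0; apply: (eq_measurable_fun (fun w => \prod_(k < 1) config_integral v w)).
  by move=> w _; rewrite big_ord1.
exact: (measurable_prod_config_integral (v := fun=> v)).
Qed.

Theorem moment_nonneg (n r : nat) (u : r.-tuple (borel X) * Omega X -> R) :
  measurable_fun setT u -> (forall q, (0 <= u q)%R) ->
  \int[P]_w config_integral u w ^+ n = partition_sum P n lambda c u.
Proof.
move=> mu u0; under eq_integral do rewrite expe_prode.
exact: (integral_prod_config_integral (v := fun _ : 'I_n => u)).
Qed.

(** Almost surely both parts of [u] have a finite sum over [w], because the
    products of [n >= 1] copies of one part have a finite mean; the power of
    their difference is then expanded in the reals. *)
Theorem moment_signed (n r : nat) (u : r.-tuple (borel X) * Omega X -> R) :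
  (0 < n)%N -> measurable_fun setT u ->
  partition_sum P n lambda c (fun q => `|u q|%R) < +oo ->
  \int[P]_w config_integral u w ^+ n = partition_sum P n lambda c u.
Proof.
move=> n0 mu uoo.
pose v (e : {ffun 'I_n -> bool}) (k : 'I_n) := signed_part (e k) \o u.
have mv e k : measurable_fun setT (v e k) by exact: measurable_signed_part.
have v0 e k q : (0 <= v e k q)%R by exact: signed_part_ge0.
pose I (b : bool) := config_integral (signed_part b \o u).
have mI b : measurable_fun setT (I b).
  apply: measurable_config_integral; first exact: measurable_signed_part.
  by move=> q; exact: signed_part_ge0.
have I0 b w : 0 <= I b w.
  by apply: config_integral_ge0 => q; exact: signed_part_ge0.
have absE : partition_sum P n lambda c (fun q => `|u q|%R) =
    \sum_(rho : partitions n r)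
      partition_term rho (fun _ : 'I_n => fun q => `|u q|%R) by [].
have abs_term_ge0 rho :
    0 <= partition_term rho (fun _ : 'I_n => fun q => `|u q|%R).
  exact: partition_term_ge0.
have uoo' rho : partition_term rho (fun _ : 'I_n => fun q => `|u q|%R) < +oo.
  apply: le_lt_trans uoo; rewrite absE (bigD1 rho)//= leeDl//.
  by apply: sume_ge0.
have vprod (e : {ffun 'I_n -> bool}) : \int[P]_w \prod_(k < n) I (e k) w =
    \sum_(rho : partitions n r) partition_term rho (v e).
  exact: (integral_prod_config_integral (v := v e)).
have iI (e : {ffun 'I_n -> bool}) : P.-integrable setT (fun w => \prod_(k < n) I (e k) w).
  apply/integrableP; split.
    exact: (measurable_prod_config_integral (v := v e)).
  under eq_integral do rewrite gee0_abs ?prode_ge0//.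
  rewrite vprod; apply: le_lt_trans uoo; rewrite absE.
  apply: lee_sum => rho _; apply: le_partition_term => //.
  - by move=> k; exact: measurableT_comp.
  - by move=> k q; exact: signed_part_le.
(* The constant pattern [b] gives the [n]-th power of [I b]. *)
have fin_ae b : \forall w \ae P, I b w \is a fin_num.
  have := integrable_ae measurableT (iI [ffun=> b]).
  apply: filterS => w /(_ Logic.I).
  rewrite (eq_bigr (fun=> I b w)); last by move=> k _; rewrite ffunE.
  rewrite -expe_prode !ge0_fin_numE ?expe_ge0//.
  rewrite !ltey; apply: contra_neq => ->.
  exact: expe_infty.
transitivity (\int[P]_w \sum_(e : {ffun 'I_n -> bool})
    (pattern_sign e)%:E * \prod_(k < n) I (e k) w).
  apply: ae_eq_integral => //.
  - apply: measurable_expe.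
    apply: (eq_measurable_fun (fun w => I false w - I true w)) => [w _|].
      by rewrite [RHS]config_integral_signed.
    exact: emeasurable_funB.
  - apply: emeasurable_sum => e; apply: measurable_funeM.
    exact: (measurable_prod_config_integral (v := v e)).
  - apply: filterS2 (fin_ae false) (fin_ae true) => w I0w I1w _.
    rewrite config_integral_signed -/(I false w) -/(I true w).
    have IE b : I b w = (fine (I b w))%:E by case: b; rewrite fineK.
    rewrite (IE false) (IE true) -EFinB -EFin_expe.
    rewrite (sum_power_signed n (fun b => fine (I b w))) -sumEFin.
    apply: eq_bigr => e _; rewrite EFinM; congr (_ * _).
    rewrite -prodEFin.
    by apply: eq_bigr => k _; rewrite -IE.
have isI (e : {ffun 'I_n -> bool}) : P.-integrable setT
    (fun w => (pattern_sign e)%:E * \prod_(k < n) I (e k) w).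
  by have := integrableZl measurableT (pattern_sign e) (iI e).
rewrite (integral_sum measurableT isI).
transitivity (\sum_(rho : partitions n r) \sum_(e : {ffun 'I_n -> bool})
    (pattern_sign e)%:E * partition_term rho (v e)); last first.
  by apply: eq_bigr => rho _; rewrite -partition_term_signed.
rewrite exchange_big; apply: eq_bigr => e _.
rewrite (integralZl measurableT (iI e)) vprod ge0_sume_distrr// => rho _.
exact: partition_term_ge0.
Qed.

End moments.

Lemma campbell_count_measurable (R : realType) (X : completePseudoMetricType R)
    (A : set (borel X)) : campbell_well_defined X -> measurable A ->
  measurable_fun setT (fun w : Omega X => config_measure R w A).
Proof.
move=> wd mA; apply: eq_measurable_fun (wd A setT mA measurableT) => w _.
rewrite /campbell_integrand (eq_integral (cst 1)) => [|x _].
  by rewrite integral_cst// mul1e.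
by rewrite indicT.
Qed.

Unset Implicit Arguments.

Theorem proposition2p2 (R : realType) (X : completePseudoMetricType R)
    (lambda : {sigma_finite_measure set (borel X) -> \bar R})
    (P : probability (Omega X) R) (c : borel X * Omega X -> \bar R)
    (n r : nat) (u : r.-tuple (borel X) * Omega X -> R) :
  polish X ->
  non_atomic lambda ->
  campbell_well_defined X ->
  papangelou_density P lambda c ->
  (1 <= n)%N -> (1 <= r)%N ->
  measurable_fun setT u ->
  (forall p, 0 <= u p)%R \/
    partition_sum P n lambda c (fun p => `|u p|%R) < +oo ->
  \int[P]_w (\int[power_measure (config_measure R w) r]_z (u (z, w))%:E) ^+ n
  = partition_sum P n lambda c u.
Proof.
move=> polX na wd hc n0 _ mu.
have [hX _] := polX; have [U bU] := polish_base_seq polX.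
have mcount A := @campbell_count_measurable R X A wd.
have [D [p Dp]] := measurable_enumeration_exists hX mcount bU.
case=> [u0|uoo].
- exact: (moment_nonneg hX bU mcount Dp na hc).
- exact: (moment_signed hX bU mcount Dp na hc).
Qed.
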